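(* Let $H$ be a finite-dimensional factorizable ribbon Hopf algebra over an algebraically closed field $k$ of characteristic zero, and let $F$ be the coregular $H$-bimodule with coproduct $\Delta_F$. Then the partial monodromy trace $t_{\mathcal Q}(\Delta_F)\in\mathrm{Hom}_{H|H}(K,F)$ of the coproduct $\Delta_F$ is $\Gamma_{1;1}$-invariant.
   Context: **Hopf algebra conventions.** $H=(H,m,\eta,\Delta,\varepsilon,S)$ is a Hopf algebra over $k$, with Sweedler notation $\Delta(h)=h_{(1)}\otimes h_{(2)}$; $\otimes=\otimes_k$; $H^*=\mathrm{Hom}_k(H,k)$. Quasitriangular: endowed with an invertible $R\in H\otimes H$ with $\Delta^{\mathrm{op}}(h)=R\,\Delta(h)R^{-1}$, $(\Delta\otimes\mathrm{id})(R)=R_{13}R_{23}$, $(\mathrm{id}\otimes\Delta)(R)=R_{13}R_{12}$. Monodromy matrix: $Q=R_{21}R$. Ribbon: endowed moreover with a central invertible $v\in H$ with $S(v)=v$, $\varepsilon(v)=1$, $\Delta(v)=(v\otimes v)Q^{-1}$. Factorizable: $Q=\sum_\ell h_\ell\otimes k_\ell$ with $\{h_\ell\}$, $\{k_\ell\}$ two vector space bases of $H$. With $R=\sum_i r_i\otimes s_i$ put $u=\sum_i S(s_i)r_i$ and $t=uv^{-1}$ (a group-like element). **(Co)integrals.** $H$ is unimodular; $\Lambda\in H$ is a non-zero two-sided integral ($h\Lambda=\varepsilon(h)\Lambda=\Lambda h$) and $\lambda\in H^*$ a non-zero right cointegral ($\lambda(h_{(1)})h_{(2)}=\lambda(h)1$),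 normalized (uniquely up to a common sign) such that $\lambda(\Lambda)=1$ and $(\lambda\otimes\mathrm{id})(Q)=\Lambda$. **The category $H$-Bimod.** Objects are finite-dimensional $H$-bimodules; $\mathrm{Hom}_{H|H}$ denotes bimodule morphisms. The tensor product is $X\otimes_k Y$ with $h.(x\otimes y)=h_{(1)}.x\otimes h_{(2)}.y$ and $(x\otimes y).h=x.h_{(1)}\otimes y.h_{(2)}$. The twist is $\theta_X(x)=v.x.v^{-1}$. **The bimodule $F$.** As a vector space $F=H^*$, with actions $(h.p)(x)=p(S(h)x)$ and $(p.h)(x)=p(x\,S^{-1}(h))$. Its coproduct $\Delta_F\colon F\to F\otimes F$ is: writing $\Delta_F(p)=\sum p'\otimes p''$, $\sum p'(y)\,p''(x)=p(x_{(1)})\,\lambda(S(x_{(2)})\,y)$ for $x,y\in H$. **The bimodule $K$.** $K=H^*\otimes H^*$, regarded as linear forms $f$ on $H\otimes H$, with $(h.f)(a\otimes b)=f(S(h_{(1)})\,a\,h_{(2)}\otimes b)$ and $(f.h)(a\otimes b)=f(a\otimes h_{(2)}\,b\,S^{-1}(h_{(1)}))$. **Partial monodromy trace.** Write $Q=\sum q_1\otimes q_2$ and $Q^{-1}=\sum \bar q_1\otimes\bar q_2$. For $f\in K$ and $x$ in a bimodule $X$ put $f\triangleright x:=\sum f(\bar q_1\otimes q_1)\;\bar q_2.x.q_2$. For $g\in\mathrm{Hom}_{H|H}(X,Y\otimes X)$ the morphism $t_{\mathcal Q}(g)\in\mathrm{Hom}_{H|H}(K,Y)$ is $t_{\mathcal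 Q}(g)(f)=\sum_i(\mathrm{id}_Y\otimes\varphi^i)\big(g(f\triangleright e_i)\big)$ with $\varphi^i(x)=e^i(t.x.t)$, where $\{e_i\}$ is a basis of $X$ and $\{e^i\}$ the dual basis. **Action of $\Gamma_{1;1}$.** The mapping class group $\Gamma_{1;1}$ of the one-punctured torus is generated by $S,T,D$ subject to $(ST)^3=S^2$, $S^4=D$. On $\mathrm{Hom}_{H|H}(K,X)$ the generators act by $g\mapsto g\circ S_K^{-1}$, $g\mapsto g\circ T_K^{-1}$ and $g\mapsto\theta_X\circ g$, respectively, where $S_K,T_K\in\mathrm{End}_{H|H}(K)$ are the invertible endomorphisms $S_K(f)(a\otimes b)=\sum f(\bar q_1\otimes q_1)\,\lambda(S(\bar q_2)\,a)\,\lambda(b\,S^{-1}(q_2))$ and $T_K(f)(a\otimes b)=f(va\otimes b\,v^{-1})$. Invariance of $g$ means that $g$ is fixed by all three generators. *)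

(* Defs.v *)
From HB Require Import structures.
From mathcomp Require Import all_boot all_order all_algebra all_field.

Set Implicit Arguments.
Unset Strict Implicit.
Unset Printing Implicit Defensive.

Import GRing.Theory VectorInternalTheory.
Local Open Scope ring_scope.

(* U (x) V for finite-dimensional U and V, as matrices of coordinates in the
   canonical bases of U and V.  [tens] is the universal bilinear map and
   [tlift f] the map on U (x) V induced by f: see [tliftE] and [tens_ind]. *)
Definition tensor (k : fieldType) (U V : vectType k) : Type :=
  'M[k]_(dim U, dim V).

HB.instance Definition _ (k : fieldType) (U V : vectType k) :=
  Vector.on (tensor U V).

Definition tens (k : fieldType) (U V : vectType k) (u : U) (v : V) :
    tensor U V := (v2r u)^T *m v2r v.

Definition tlift (k : fieldType) (U V : vectType k) (W : lmodType k)
    (f : U -> V -> W) (t : tensor U V) : W :=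
  \sum_(i < dim U) \sum_(j < dim V)
     (t : 'M_(_, _)) i j *: f (r2v (delta_mx 0 i)) (r2v (delta_mx 0 j)).

Declare Scope hopf_scope.
Delimit Scope hopf_scope with hopf.
Local Open Scope hopf_scope.

Notation "u '\ox' v" := (tens u v)
  (at level 38, right associativity) : hopf_scope.

(* Sweedler-style sums: if t = \sum_i a_i (x) b_i and E is bilinear in (a, b),
   then \tsum_( a , b <- t ) E is \sum_i E[a_i, b_i]. *)
Notation "'\tsum_' ( a , b <- t ) E" := (tlift (fun a b => E) t)
  (at level 41, a name, b name, t at level 200, E at level 41,
   format "'\tsum_' ( a ,  b  <-  t )  E") : hopf_scope.

Lemma lin_fun0 (k : fieldType) (X W : lmodType k) (f : X -> W) :
  linear f -> f 0 = 0.
Proof. by move=> fl; have := fl (-1) 0 0; rewrite addr0 scaler0 scaleN1r addNr. Qed.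
Lemma lin_funE (k : fieldType) (X W : vectType k) (f : X -> W) (x : X) :
  linear f -> linfun f x = f x.
Proof.
move=> fl; pose fL := GRing.isLinear.Build k X W _ f fl.
by pose F : {linear X -> W} := HB.pack f fL; rewrite -[f]/(F : X -> W) lfunE.
Qed.

Lemma linear_sum_fun (k : fieldType) (X W : lmodType k) (f : X -> W) n
    (c : 'I_n -> k) (x : 'I_n -> X) :
  linear f -> f (\sum_i c i *: x i) = \sum_i c i *: f (x i).
Proof.
move=> fl; apply: (big_ind2 (fun y z => f y = z)) => [|y z y' z' <- <-|i _].
- exact: lin_fun0.
- by rewrite -[y]scale1r fl !scale1r.
- by rewrite -[_ *: x i]addr0 fl lin_fun0 // !addr0.
Qed.

Section TensorTheory.
Variables (k : fieldType) (U V : vectType k).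

Lemma tens_linl (v : V) : linear (fun u : U => u \ox v).
Proof.
by move=> c u u'; rewrite /tens linearP /= linearP /= mulmxDl -scalemxAl.
Qed.

Lemma tens_linr (u : U) : linear (fun v : V => u \ox v).
Proof. by move=> c v v'; rewrite /tens linearP mulmxDr -scalemxAr. Qed.

Lemma tlift_linear (W : lmodType k) (f : U -> V -> W) : linear (tlift f).
Proof.
move=> c t t'; rewrite /tlift scaler_sumr -big_split; apply: eq_bigr => i _.
rewrite scaler_sumr -big_split; apply: eq_bigr => j _ /=.
by rewrite !mxE scalerDl scalerA.
Qed.
HB.instance Definition _ (W : lmodType k) (f : U -> V -> W) :=
  GRing.isLinear.Build k (tensor U V) W _ (tlift f) (tlift_linear f).

Lemma linear_r2v (X : vectType k) (W : lmodType k) (f : X -> W) (x : X) :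
  linear f -> f x = \sum_i v2r x 0 i *: f (r2v (delta_mx 0 i)).
Proof.
move=> fl; pose fL := GRing.isLinear.Build k X W _ f fl.
pose F : {linear X -> W} := HB.pack f fL.
rewrite -[LHS]/(F x) -[x in LHS]v2rK [v2r x in LHS]row_sum_delta.
by rewrite linear_sum linear_sum; apply: eq_bigr => i _; rewrite !linearZ.
Qed.

Lemma tliftE (W : lmodType k) (f : U -> V -> W) (u : U) (v : V) :
  (forall v, linear (fun u => f u v)) -> (forall u, linear (f u)) ->
  tlift f (u \ox v) = f u v.
Proof.
move=> fl fr; rewrite (linear_r2v u (fl v)); apply: eq_bigr => i _.
rewrite (linear_r2v v (fr _)) scaler_sumr; apply: eq_bigr => j _.
by rewrite scalerA /tens !mxE big_ord_recl big_ord0 addr0 !mxE.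
Qed.

Lemma tens_ind (P : tensor U V -> Prop) :
  P 0 -> (forall c s t, P s -> P t -> P (c *: s + t)) ->
  (forall u v, P (u \ox v)) -> forall t, P t.
Proof.
move=> P0 PD Pt t.
have -> : t = \tsum_(a, b <- t) (a \ox b).
  rewrite /tlift [LHS]matrix_sum_delta; apply: eq_bigr => i _.
  apply: eq_bigr => j _; congr (_ *: _).
  by rewrite /tens !r2vK trmx_delta mul_delta_mx.
rewrite /tlift; apply: (big_ind P) => // [s s'|i _].
  by rewrite -[s + s']/(s + s') -{2}[s]scale1r; apply: PD.
apply: (big_ind P) => // [s s'|j _]; first by rewrite -{2}[s]scale1r; apply: PD.
by rewrite -[X in P X]addr0; apply: PD.
Qed.

Lemma eq_tensor (W : lmodType k) (f g : tensor U V -> W) :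
  linear f -> linear g -> (forall u v, f (u \ox v) = g (u \ox v)) -> f =1 g.
Proof.
move=> fl gl fg; apply: tens_ind => [||//].
- by rewrite !lin_fun0.
- by move=> c s t fs ft; rewrite fl gl fs ft.
Qed.

Lemma tlift_linear_fun (W : lmodType k) (X : lmodType k) (f : X -> U -> V -> W)
    (t : tensor U V) :
  (forall u v, linear (fun x => f x u v)) -> linear (fun x => tlift (f x) t).
Proof.
move=> fl c x y; rewrite /tlift scaler_sumr -big_split; apply: eq_bigr => i _.
rewrite scaler_sumr -big_split; apply: eq_bigr => j _ /=.
by rewrite fl scalerDr !scalerA mulrC.
Qed.

End TensorTheory.

Section TensorAlgebra.
Variables (k : fieldType) (A B : falgType k).
Implicit Types s t w : tensor A B.

Definition tone : tensor A B := 1 \ox 1.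

Definition tmul s t : tensor A B :=
  \tsum_(a, b <- s) \tsum_(c, d <- t) ((a * c) \ox (b * d)).

Lemma tmulE (a c : A) (b d : B) :
  tmul (a \ox b) (c \ox d) = (a * c) \ox (b * d).
Proof.
rewrite /tmul tliftE => [|b'|a'].
- rewrite tliftE => [//|b'|a'] e x y; first by rewrite mulrDr -scalerAr tens_linl.
  by rewrite mulrDr -scalerAr tens_linr.
- apply: tlift_linear_fun => c' d' e x y.
  by rewrite mulrDl -scalerAl tens_linl.
- apply: tlift_linear_fun => c' d' e x y.
  by rewrite mulrDl -scalerAl tens_linr.
Qed.

Lemma tmul_linl t : linear (tmul^~ t).
Proof. exact: tlift_linear. Qed.

Lemma tmul_linr s : linear (tmul s).
Proof. by apply: tlift_linear_fun => a b; apply: tlift_linear. Qed.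

Lemma tmulA : associative tmul.
Proof.
have z x : tmul x 0 = 0 := lin_fun0 (tmul_linr x).
have z' x : tmul 0 x = 0 := lin_fun0 (tmul_linl x).
move=> s t w; move: s; apply: tens_ind => [|e s s' IH IH'|a b].
- by rewrite !z'.
- by rewrite !tmul_linl IH IH'.
move: t; apply: tens_ind => [|e t t' IH IH'|c d].
- by rewrite z z' z.
- by rewrite !(tmul_linl, tmul_linr) IH IH'.
move: w; apply: tens_ind => [|e w w' IH IH'|x y]; first by rewrite !z.
  by rewrite !tmul_linr IH IH'.
by rewrite !tmulE !mulrA.
Qed.

Lemma tmul1 : left_id tone tmul.
Proof.
apply: eq_tensor => [|//|a b]; first exact: tmul_linr.
by rewrite tmulE !mul1r.
Qed.

Lemma tmulr1 : right_id tone tmul.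
Proof.
apply: (eq_tensor (f := tmul^~ tone)) => [|//|a b]; first exact: tmul_linl.
by rewrite tmulE !mulr1.
Qed.

Lemma tmulDl : left_distributive tmul +%R.
Proof. by move=> s t w; rewrite -[s]scale1r tmul_linl !scale1r. Qed.

Lemma tmulDr : right_distributive tmul +%R.
Proof. by move=> w s t; rewrite -[s]scale1r tmul_linr !scale1r. Qed.

Lemma tone_neq0 : tone != 0.
Proof.
have v2r1_neq0 (C : falgType k) : v2r (1 : C) != 0.
  by apply/eqP; rewrite -(linear0 v2r) => /v2r_inj/eqP; rewrite oner_eq0.
have /rV0Pn[i i0] := v2r1_neq0 A; have /rV0Pn[j j0] := v2r1_neq0 B.
apply/eqP => /matrixP/(_ i j).
rewrite /tone /tens !mxE big_ord_recl big_ord0 addr0 !mxE => /eqP.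
by rewrite mulf_eq0 (negPf i0) (negPf j0).
Qed.

HB.instance Definition _ := GRing.Zmodule_isNzRing.Build (tensor A B)
  tmulA tmul1 tmulr1 tmulDl tmulDr tone_neq0.

Lemma tscalerAl c s t : c *: (s * t) = (c *: s) * t.
Proof. by rewrite -[c *: s]addr0 [RHS]tmul_linl (lin_fun0 (tmul_linl t)) addr0. Qed.

Lemma tscalerAr c s t : c *: (s * t) = s * (c *: t).
Proof. by rewrite -[c *: t]addr0 [RHS]tmul_linr (lin_fun0 (tmul_linr s)) addr0. Qed.

HB.instance Definition _ := GRing.Lmodule_isLalgebra.Build k (tensor A B)
  tscalerAl.
HB.instance Definition _ := GRing.Lalgebra_isAlgebra.Build k (tensor A B)
  tscalerAr.
HB.instance Definition _ := Algebra_isFalgebra.Build k (tensor A B).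

Lemma tensM (a c : A) (b d : B) :
  (a \ox b) * (c \ox d) = (a * c) \ox (b * d).
Proof. exact: tmulE. Qed.

Lemma tens1 : 1 \ox 1 = 1 :> tensor A B.
Proof. by []. Qed.

End TensorAlgebra.

Definition tswap (k : fieldType) (U V : vectType k) (t : tensor U V) :
  tensor V U := \tsum_(u, v <- t) (v \ox u).

Notation dual k U := 'Hom(U, k^o).

(* Finite-dimensional Hopf algebras: the finite-dimensional algebra H is the
   carrier.  All threefold tensors live in H (x) (H (x) H). *)
Record hopf (k : fieldType) (H : falgType k) := Hopf {
  comul : {lrmorphism H -> tensor H H};
  counit : {lrmorphism H -> k^o};
  antipode : 'End(H);
  comulA : forall h,
    \tsum_(a, b <- comul h) \tsum_(a1, a2 <- comul a) (a1 \ox a2 \ox b)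
      = \tsum_(a, b <- comul h) \tsum_(b1, b2 <- comul b) (a \ox b1 \ox b2);
  counitl : forall h, \tsum_(a, b <- comul h) ((counit a : k) *: b) = h;
  counitr : forall h, \tsum_(a, b <- comul h) ((counit b : k) *: a) = h;
  antipodel : forall h,
    \tsum_(a, b <- comul h) (antipode a * b) = (counit h : k) *: 1;
  antipoder : forall h,
    \tsum_(a, b <- comul h) (a * antipode b) = (counit h : k) *: 1 }.

Section RibbonHopf.
Variables (k : fieldType) (H : falgType k) (A : hopf H).
Local Notation cop := (comul A).
Local Notation eps := (counit A).
Local Notation S := (antipode A).
Local Notation Si := (antipode A)^-1%VF.

Definition quasitriangular (R : tensor H H) : Prop :=
  [/\ R \is a GRing.unit,
      forall h, tswap (cop h) = R * cop h * R^-1,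
      (* (Delta (x) id)(R) = R_13 R_23 *)
      \tsum_(a, b <- R) \tsum_(a1, a2 <- cop a) (a1 \ox a2 \ox b)
        = (\tsum_(a, b <- R) (a \ox 1 \ox b))
          * (\tsum_(a, b <- R) (1 \ox a \ox b))
    & (* (id (x) Delta)(R) = R_13 R_12 *)
      \tsum_(a, b <- R) (a \ox cop b)
        = (\tsum_(a, b <- R) (a \ox 1 \ox b))
          * (\tsum_(a, b <- R) (a \ox b \ox 1))].

Definition monodromy (R : tensor H H) : tensor H H := tswap R * R.

Definition ribbon (R : tensor H H) (v : H) : Prop :=
  [/\ v \is a GRing.unit, forall h, v * h = h * v, S v = v,
      eps v = 1 & cop v = (v \ox v) * (monodromy R)^-1].

Definition factorizable (R : tensor H H) : Prop :=
  exists n (h l : n.-tuple H),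
    [/\ basis_of {:H} h, basis_of {:H} l
      & monodromy R = \sum_(i < n) tnth h i \ox tnth l i].

Definition drinfeld_element (R : tensor H H) : H :=
  \tsum_(r, s <- R) (S s * r).

Definition balancing (R : tensor H H) (v : H) : H := drinfeld_element R * v^-1.

Definition two_sided_integral (Lam : H) : Prop :=
  forall h, h * Lam = (eps h : k) *: Lam /\ Lam * h = (eps h : k) *: Lam.

Definition right_cointegral (lam : dual k H) : Prop :=
  forall h, \tsum_(a, b <- cop h) ((lam a : k) *: b) = (lam h : k) *: 1.

Definition normalized_integrals (R : tensor H H) (Lam : H) (lam : dual k H) :
    Prop :=
  [/\ two_sided_integral Lam /\ Lam <> 0, right_cointegral lam /\ lam <> 0,
      lam Lam = 1 & \tsum_(a, b <- monodromy R) ((lam a : k) *: b) = Lam].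

(* A finite-dimensional space with two operations of H; it is an object of
   H-Bimod when it satisfies [is_bimod]. *)
Record biact := Biact {
  bcar :> vectType k;
  lact : H -> bcar -> bcar;
  ract : bcar -> H -> bcar }.

Record is_bimod (X : biact) : Prop := IsBimod {
  lact_linl : forall x : X, linear (fun h => lact h x);
  lact_linr : forall h, linear (@lact X h);
  ract_linl : forall h, linear (fun x : X => ract x h);
  ract_linr : forall x : X, linear (ract x);
  lact1 : forall x : X, lact 1 x = x;
  lactM : forall g h (x : X), lact (g * h) x = lact g (lact h x);
  ract1 : forall x : X, ract x 1 = x;
  ractM : forall (x : X) g h, ract x (g * h) = ract (ract x g) h;
  lractA : forall g (x : X) h, lact g (ract x h) = ract (lact g x) h }.

(* g belongs to Hom_{H|H}(X, Y); this includes that X and Y are bimodules. *)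
Record bimod_hom (X Y : biact) (g : 'Hom(X, Y)) : Prop := BimodHom {
  bimod_hom_dom : is_bimod X;
  bimod_hom_cod : is_bimod Y;
  bimod_homl : forall h x, g (lact h x) = lact h (g x);
  bimod_homr : forall x h, g (ract x h) = ract (g x) h }.

Definition tens_bimod (X Y : biact) : biact := @Biact (tensor X Y)
  (fun h t => \tsum_(h1, h2 <- cop h) \tsum_(x, y <- t) (lact h1 x \ox lact h2 y))
  (fun t h => \tsum_(h1, h2 <- cop h) \tsum_(x, y <- t) (ract x h1 \ox ract y h2)).

Definition twist (v : H) (X : biact) : 'End(X) :=
  linfun (fun x : X => ract (lact v x) v^-1).

Definition F_bimod : biact := @Biact (dual k H)
  (fun h p => linfun (fun x => p (S h * x)))
  (fun p h => linfun (fun x => p (x * Si h))).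

(* The element of H^* (x) H^* that evaluates to b y x at (y, x). *)
Definition dual_tensor (b : H -> H -> k) : tensor (dual k H) (dual k H) :=
  \sum_(i < \dim {:H}) \sum_(j < \dim {:H})
     b (vbasis {:H})`_i (vbasis {:H})`_j
       *: ((linfun (coord (vbasis {:H}) i : H -> k^o))
             \ox (linfun (coord (vbasis {:H}) j : H -> k^o))).

Definition F_comul (lam : dual k H) : 'Hom(F_bimod, tens_bimod F_bimod F_bimod) :=
  linfun (fun p : dual k H => dual_tensor (fun y x =>
    \tsum_(x1, x2 <- cop x) (p x1 * lam (S x2 * y)))).

(* The coend K = H^* (x) H^*, as linear forms on H (x) H. *)
Definition K_bimod : biact := @Biact (dual k (tensor H H))
  (fun h f => linfun (fun t => \tsum_(a, b <- t)
     \tsum_(h1, h2 <- cop h) f ((S h1 * a * h2) \ox b)))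
  (fun f h => linfun (fun t => \tsum_(a, b <- t)
     \tsum_(h1, h2 <- cop h) f (a \ox (h2 * b * Si h1)))).

Section Monodromy.
Variables (R : tensor H H) (v : H) (lam : dual k H).
Local Notation Q := (monodromy R).

Definition mon_act (X : biact) (f : K_bimod) (x : X) : X :=
  \tsum_(q1', q2' <- Q^-1) \tsum_(q1, q2 <- Q)
     ((f (q1' \ox q1) : k) *: ract (lact q2' x) q2).

Definition monodromy_trace (X Y : biact) (g : 'Hom(X, tens_bimod Y X)) :
    'Hom(K_bimod, Y) :=
  let e := vbasis {:X} in let t := balancing R v in
  linfun (fun f : K_bimod => \sum_(i < \dim {:X})
    \tsum_(y, x <- g (mon_act f e`_i)) (coord e i (ract (lact t x) t) *: y)).

Definition S_K : 'End(K_bimod) :=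
  linfun (fun f : dual k (tensor H H) => linfun (fun t : tensor H H =>
    \tsum_(a, b <- t) \tsum_(q1', q2' <- Q^-1) \tsum_(q1, q2 <- Q)
      (f (q1' \ox q1) * lam (S q2' * a) * lam (b * Si q2)))).

Definition T_K : 'End(K_bimod) :=
  linfun (fun f : dual k (tensor H H) => linfun (fun t : tensor H H =>
    \tsum_(a, b <- t) f ((v * a) \ox (b * v^-1)))).

(* Being fixed by the generators S, T and D of the mapping class group of the
   one-punctured torus acting on Hom_{H|H}(K, X). *)
Definition Gamma11_invariant (X : biact) (g : 'Hom(K_bimod, X)) : Prop :=
  [/\ (g \o S_K^-1)%VF = g, (g \o T_K^-1)%VF = g & (twist v X \o g)%VF = g].

End Monodromy.

(* The maps given to [linfun] above are linear, so that they compute. *)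
Section Evaluation.
Implicit Types (p : dual k H) (f : dual k (tensor H H)) (a b h x y : H).

Lemma F_lactE h p x : (@lact F_bimod h p : dual k H) x = p (S h * x).
Proof. by rewrite lin_funE // => c y z; rewrite mulrDr -scalerAr linearP. Qed.

Lemma F_ractE p h x : (@ract F_bimod p h : dual k H) x = p (x * Si h).
Proof. by rewrite lin_funE // => c y z; rewrite mulrDl -scalerAl linearP. Qed.

Lemma dual_tensorE (b : H -> H -> k^o) y x :
  (forall x, linear (fun y => b y x)) -> (forall y, linear (b y)) ->
  tlift (fun p p' : dual k H => p y * p' x : k^o) (dual_tensor b) = b y x.
Proof.
move=> bl br; have vb z := coord_vbasis (memvf (z : H)).
have ebl := fun z => linear_sum_fun (fun i : 'I__ => coord (vbasis {:H}) i y)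
  (fun i => (vbasis {:H})`_i) (bl z).
have ebr := fun z => linear_sum_fun (fun i : 'I__ => coord (vbasis {:H}) i x)
  (fun i => (vbasis {:H})`_i) (br z).
rewrite [in RHS](vb y) ebl /dual_tensor linear_sum; apply: eq_bigr => i _.
rewrite [in RHS](vb x) ebr linear_sum scaler_sumr; apply: eq_bigr => j _.
rewrite linearZ /= tliftE => [|q c p p'|p c q q'] /=.
- by rewrite !lfunE /= /GRing.scale /= mulrC -mulrA [_ * b _ _]mulrC mulrA.
- by rewrite add_lfunE scale_lfunE mulrDl -scalerAl.
- by rewrite add_lfunE scale_lfunE mulrDr -scalerAr.
Qed.

Lemma F_comulE (lam : dual k H) p x y :
  tlift (fun p1 p2 : dual k H => p1 y * p2 x : k^o) (F_comul lam p)
    = \tsum_(x1, x2 <- cop x) (p x1 * lam (S x2 * y)).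
Proof.
rewrite lin_funE; last first.
  move=> c p1 p2; rewrite scaler_sumr -big_split; apply: eq_bigr => i _ /=.
  rewrite scaler_sumr -big_split; apply: eq_bigr => j _ /=.
  rewrite scalerA -scalerDl; congr (_ *: _).
  rewrite (tlift_linear_fun (f := fun p x1 x2 => p x1 * lam (S x2 * _) : k^o)) //.
  by move=> u w e q q'; rewrite add_lfunE scale_lfunE mulrDl -scalerAl.
rewrite dual_tensorE // => [x' c y1 y2|y' c x1 x2]; last first.
  by rewrite linearP (tlift_linear (fun x1 x2 => p x1 * lam (S x2 * y') : k^o)).
apply: (tlift_linear_fun (f := fun y x1 x2 => p x1 * lam (S x2 * y) : k^o)).
move=> u w e z z'.
by rewrite mulrDr -scalerAr linearP mulrDr -scalerAr.
Qed.

Lemma K_lactE h f a b : (@lact K_bimod h f : dual k (tensor H H)) (a \ox b)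
  = \tsum_(h1, h2 <- cop h) f ((S h1 * a * h2) \ox b).
Proof.
rewrite lin_funE ?tliftE //; last exact: tlift_linear.
- move=> z; apply: tlift_linear_fun => u w c x y.
  by rewrite mulrDr mulrDl -scalerAr -scalerAl tens_linl linearP.
- move=> z; apply: tlift_linear_fun => u w c x y.
  by rewrite tens_linr linearP.
Qed.

Lemma K_ractE f h a b : (@ract K_bimod f h : dual k (tensor H H)) (a \ox b)
  = \tsum_(h1, h2 <- cop h) f (a \ox (h2 * b * Si h1)).
Proof.
rewrite lin_funE ?tliftE //; last exact: tlift_linear.
- by move=> z; apply: tlift_linear_fun => u w c x y; rewrite tens_linl linearP.
- move=> z; apply: tlift_linear_fun => u w c x y.
  by rewrite mulrDr mulrDl -scalerAr -scalerAl tens_linr linearP.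
Qed.

Lemma S_KE R (lam : dual k H) f a b :
  (S_K R lam f : dual k (tensor H H)) (a \ox b)
  = \tsum_(q1', q2' <- (monodromy R)^-1) \tsum_(q1, q2 <- monodromy R)
      (f (q1' \ox q1) * lam (S q2' * a) * lam (b * Si q2)).
Proof.
rewrite lin_funE; last first.
  move=> c f1 f2; apply/lfunP => t; rewrite add_lfunE scale_lfunE.
  rewrite !lin_funE; try exact: tlift_linear.
  move: t c f1 f2; move=> t; apply: tlift_linear_fun => z z'.
  apply: tlift_linear_fun => u u'; apply: tlift_linear_fun => w w' c f1 f2.
  by rewrite add_lfunE scale_lfunE !mulrDl -!(scalerAl c).
rewrite lin_funE ?tliftE //; last exact: tlift_linear.
- move=> z; apply: tlift_linear_fun => u u'.
  apply: tlift_linear_fun => w w' c x y.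
  by rewrite mulrDr -(scalerAr c) linearP mulrDr mulrDl -(scalerAr c) -(scalerAl c).
- move=> z; apply: tlift_linear_fun => u u'.
  apply: tlift_linear_fun => w w' c x y.
  by rewrite mulrDl -(scalerAl c) linearP mulrDr -(scalerAr c).
Qed.

Lemma T_KE v f a b : (T_K v f : dual k (tensor H H)) (a \ox b)
  = f ((v * a) \ox (b * v^-1)).
Proof.
rewrite lin_funE; last first.
  move=> c f1 f2; apply/lfunP => t; rewrite add_lfunE scale_lfunE.
  rewrite !lin_funE; try exact: tlift_linear.
  move: t c f1 f2; move=> t; apply: tlift_linear_fun => z z' c f1 f2.
  by rewrite add_lfunE scale_lfunE.
rewrite lin_funE ?tliftE //; last exact: tlift_linear.
- by move=> z c x y; rewrite mulrDr -scalerAr tens_linl linearP.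
- by move=> z c x y; rewrite mulrDl -scalerAl tens_linr linearP.
Qed.

Lemma twistE v (X : biact) (x : X) :
  is_bimod X -> twist v X x = ract (lact v x) v^-1.
Proof.
by move=> bX; rewrite lin_funE // => c y z; rewrite lact_linr // ract_linl.
Qed.

Lemma mon_act_linear R (X : biact) (x : X) :
  linear (fun f : K_bimod => mon_act R f x).
Proof.
apply: tlift_linear_fun => u u'; apply: tlift_linear_fun => w w' c f1 f2.
by rewrite add_lfunE scale_lfunE scalerDl -scalerA.
Qed.

Lemma monodromy_traceE R v (X Y : biact) (g : 'Hom(X, tens_bimod Y X))
    (f : K_bimod) :
  monodromy_trace R v g f = \sum_(i < \dim {:X})
    \tsum_(y, x <- g (mon_act R f (vbasis {:X})`_i))
      (coord (vbasis {:X}) i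
         (ract (lact (balancing R v) x) (balancing R v)) *: y).
Proof.
rewrite lin_funE // => c f1 f2.
rewrite scaler_sumr -big_split; apply: eq_bigr => i _ /=.
rewrite -(tlift_linear _ c) -linearP; congr (tlift _ (g _)).
exact: mon_act_linear.
Qed.

End Evaluation.
End RibbonHopf.

(* Main.v *)
Require Import Defs.
From HB Require Import structures.
From mathcomp Require Import all_boot all_order all_algebra all_field.

(* Write L for Lam and Q^-1 = p (x) p', Q = q (x) q'.  The rank-one shape of
   the coproduct of F turns the trace into
     tr f y = sum f (p (x) q) lam (S (p' y_1) y_2 S^-1 q'),
   the balancing being absorbed by lam o S = lam (t^2 _) and by the fact that
   conjugation by t is S^2.  Applying Delta to (lam (x) id) Q = L gives
   L_1 (x) L_2 = sum lam (S p' q) p (x) q'; since Q^-1 commutes with the image of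
   Delta, tr is therefore also given by
     tr f y = sum f (L_1 S^-1 y_1 (x) S L_2 y_2).
   T- and D-invariance hold because v is central and L is an integral.
   Substituting S_K f in the second formula and using that
   h = sum lam (S h L_1) L_2 for all h returns the first one, which is the
   S-invariance. *)

Set Implicit Arguments.
Unset Strict Implicit.
Unset Printing Implicit Defensive.

Import GRing.Theory VectorInternalTheory.
Local Open Scope ring_scope.
Local Open Scope hopf_scope.

(** * Multilinear maps and tensors *)

(** The two formulas for tr have different roles: the one by L contains no Q, so substituting S_K f
    inserts exactly one copy of Q^-1 and one of Q; the lam that meets L_1 is then resolved and the
    other lam remains, as in the first formula. The constant t^2 measures the asymmetry of Delta L,
    namely L_2 (x) L_1 = t^-1 L_1 t^-1 (x) L_2: conjugating Delta L by R and sweeping the legs of R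
    across L assembles S u and its inverse, and v^2 = S(u) u turns these into t. As sum lam (L_2)
    L_1 = t^2 is invertible, a functional f is determined by sum f (L_1) L_2, and identities for lam
    are proved by comparing such sums. The inverses [^-1%VF] are total operations, so S, S_K and T_K
    have to be shown injective. For S and S_K this comes from the dual bases L_1, L_2; S_K also
    requires that the first legs of Q^-1 and of Q span H, which is read off the expression of Delta
    L through Q. *)

Section Multilinear.
Variable k : fieldType.
Implicit Types U V W X : lmodType k.

Definition lin2 U V W (E : U -> V -> W) : Prop :=
  (forall v, linear (E^~ v)) /\ (forall u, linear (E u)).

Definition lin3 U V W X (E : U -> V -> W -> X) : Prop :=
  (forall w, lin2 (fun u v => E u v w)) /\ (forall u v, linear (E u v)).

Lemma lin_funZ U V (f : U -> V) c x : linear f -> f (c *: x) = c *: f x.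
Proof. by move=> fl; rewrite -[c *: x]addr0 fl lin_fun0 // addr0. Qed.

Lemma lin_id U : linear (fun x : U => x). Proof. by []. Qed.

Lemma lin_comp U V W (g : V -> W) (f : U -> V) :
  linear g -> linear f -> linear (fun x => g (f x)).
Proof. by move=> gl fl c x y; rewrite fl gl. Qed.

Lemma lin_linear U V (g : {linear U -> V}) : linear g.
Proof. exact: linearP. Qed.

Lemma lin_add U W (f g : U -> W) :
  linear f -> linear g -> linear (fun x => f x + g x).
Proof. by move=> fl gl c x y; rewrite fl gl scalerDr addrACA. Qed.

Lemma lin_scaler U W (c : k) (f : U -> W) :
  linear f -> linear (fun x => c *: f x).
Proof. by move=> fl d x y; rewrite fl scalerDr !scalerA mulrC. Qed.

Lemma lin_scalel U W (f : U -> k^o) (w : W) :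
  linear f -> linear (fun x => (f x : k) *: w).
Proof. by move=> fl d x y; rewrite fl scalerDl scalerA. Qed.

Lemma lin_mull U (B : falgType k) (f : U -> B) (b : B) :
  linear f -> linear (fun x => f x * b).
Proof. by move=> fl d x y; rewrite fl mulrDl -scalerAl. Qed.

Lemma lin_mulr U (B : falgType k) (f : U -> B) (b : B) :
  linear f -> linear (fun x => b * f x).
Proof. by move=> fl d x y; rewrite fl mulrDr -scalerAr. Qed.

Lemma lin_kmull U (f : U -> k^o) (b : k) :
  linear f -> linear (fun x => f x * b : k^o).
Proof. by move=> fl d x y; rewrite fl mulrDl /GRing.scale /= mulrA. Qed.

Lemma lin_kmulr U (f : U -> k^o) (b : k) :
  linear f -> linear (fun x => b * f x : k^o).
Proof. by move=> fl d x y; rewrite fl mulrDr /GRing.scale /= mulrCA. Qed.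

Lemma lin_tensl U (X Y : vectType k) (f : U -> X) (y : Y) :
  linear f -> linear (fun x => f x \ox y).
Proof. by move=> fl d u w; rewrite fl tens_linl. Qed.

Lemma lin_tensr U (X Y : vectType k) (f : U -> Y) (y : X) :
  linear f -> linear (fun x => y \ox f x).
Proof. by move=> fl d u w; rewrite fl tens_linr. Qed.

Lemma lin_tlift (X Y : vectType k) U W (F : X -> Y -> W) (f : U -> tensor X Y) :
  linear f -> linear (fun x => tlift F (f x)).
Proof. by move=> fl d u w; rewrite fl tlift_linear. Qed.

Lemma lin_app U (X Y : vectType k) (f : U -> 'Hom(X, Y)) (x : X) :
  linear f -> linear (fun u => f u x).
Proof. by move=> fl d u w; rewrite fl add_lfunE scale_lfunE. Qed.

End Multilinear.

(** Linearity is checked in one variable at a time, so this variable sits in a single factor of each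
    product or tensor; [first] finds which one. *)
Ltac lin_step :=
  lazymatch goal with
  | |- lin3 _ => split; [intro; split; intro | intros]
  | |- lin2 _ => split; intro
  | |- GRing.linear_for _ (fun x => x) => exact: lin_id
  | |- GRing.linear_for _ (fun x => @GRing.add _ (@?f x) (@?g x)) =>
       apply: (lin_add (f := f) (g := g))
  | |- GRing.linear_for _ (fun x => @GRing.scale _ _ (@?f x) (@?g x)) =>
       first [apply: (lin_scaler _ (f := g)) | apply: (lin_scalel _ (f := f))]
  | |- GRing.linear_for _ (fun x => @GRing.mul _ (@?f x) (@?g x)) =>
       first [ apply: (lin_mull _ (f := f)) | apply: (lin_mulr _ (f := g))
             | apply: (lin_kmull _ (f := f)) | apply: (lin_kmulr _ (f := g))]
  | |- GRing.linear_for _ (fun x => tens (@?f x) (@?g x)) =>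
       first [apply: (lin_tensl _ (f := f)) | apply: (lin_tensr _ (f := g))]
  | |- GRing.linear_for _ (fun x => tlift (@?F x) (@?f x)) =>
       first [ apply: (lin_tlift _ (f := f))
             | apply: (tlift_linear_fun _ (f := F)); intros]
  | |- GRing.linear_for _ (fun x => _) =>
       match goal with
       | |- GRing.linear_for _ (fun x => fun_of_lfun (@?f x) _) =>
            apply: (lin_app _ (f := f))
       | |- GRing.linear_for _ (fun x => ?g x) => exact: lin_linear
       | |- GRing.linear_for _ (fun x => ?g (@?f x)) =>
            apply: (lin_comp (g := g) (f := f))
       | |- GRing.linear_for _ (fun x => ?g (@?f x) _) =>
            apply: (lin_comp (g := fun y => g y _) (f := f))
       | |- GRing.linear_for _ (fun x => ?g (@?f x) _ _) =>
            apply: (lin_comp (g := fun y => g y _ _) (f := f))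
       end
  | |- GRing.linear_for _ ?f =>
       first [exact: lin_linear | refine (_ : linear (fun x => f x))]
  end.

Ltac lin := intros; solve [repeat first
  [ assumption
  | match goal with
    | h : lin2 _ |- _ => first [exact: h.1 | exact: h.2]
    | h : lin3 _ |- _ => first [exact: (h.1 _).1 | exact: (h.1 _).2 | exact: h.2]
    end
  | progress cbv beta
  | lin_step ]].

Section TLift.
Variable k : fieldType.
Implicit Types (U V X Y : vectType k) (W Z : lmodType k).

Lemma eq_tlift U V W (E F : U -> V -> W) (t : tensor U V) :
  (forall a b, E a b = F a b) -> tlift E t = tlift F t.
Proof.
by move=> EF; apply: eq_bigr => i _; apply: eq_bigr => j _; rewrite EF.
Qed.

Lemma tlift_tens U V W (E : U -> V -> W) a b : lin2 E -> tlift E (a \ox b) = E a b.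
Proof. by case=> El Er; apply: tliftE. Qed.

Lemma lin_tliftE U V W Z (f : W -> Z) (E : U -> V -> W) (t : tensor U V) :
  linear f -> f (tlift E t) = \tsum_(a, b <- t) f (E a b).
Proof.
move=> fl; have f0 := lin_fun0 fl.
have fD x y : f (x + y) = f x + f y by rewrite -[x]scale1r fl !scale1r.
have fZ c x : f (c *: x) = c *: f x by rewrite -[c *: x]addr0 fl f0 addr0.
rewrite /tlift (big_morph f fD f0); apply: eq_bigr => i _.
by rewrite (big_morph f fD f0); apply: eq_bigr => j _; rewrite fZ.
Qed.

Lemma tlift_tlift U V X Y W (E : X -> Y -> W) (F : U -> V -> tensor X Y) t :
  tlift E (tlift F t) = \tsum_(a, b <- t) tlift E (F a b).
Proof. by apply: lin_tliftE; exact: tlift_linear. Qed.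

Lemma lfun_tlift U V X Y (f : 'Hom(X, Y)) (E : U -> V -> X) t :
  f (tlift E t) = \tsum_(a, b <- t) f (E a b).
Proof. by apply: lin_tliftE; exact: linearP. Qed.

Lemma tlift_mull U V (B : falgType k) (E : U -> V -> B) t x :
  tlift E t * x = \tsum_(a, b <- t) (E a b * x).
Proof. by apply: (lin_tliftE (f := fun y => y * x)); lin. Qed.

Lemma tlift_mulr U V (B : falgType k) (E : U -> V -> B) t x :
  x * tlift E t = \tsum_(a, b <- t) (x * E a b).
Proof. by apply: lin_tliftE; lin. Qed.

Lemma tlift_scaler U V W (E : U -> V -> W) t (c : k) :
  c *: tlift E t = \tsum_(a, b <- t) (c *: E a b).
Proof. by apply: lin_tliftE; lin. Qed.

Lemma tlift_lincomb U V W (E F : U -> V -> W) t (c : k) :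
  c *: tlift E t + tlift F t = \tsum_(a, b <- t) (c *: E a b + F a b).
Proof.
rewrite tlift_scaler /tlift -big_split; apply: eq_bigr => i _.
by rewrite -big_split; apply: eq_bigr => j _; rewrite scalerDr.
Qed.

Lemma tlift_scalel U V W (E : U -> V -> k^o) t (w : W) :
  (tlift E t : k) *: w = \tsum_(a, b <- t) ((E a b : k) *: w).
Proof. by apply: (lin_tliftE (f := fun y : k^o => (y : k) *: w)); lin. Qed.

Lemma tlift_sum U V W n (F : 'I_n -> U -> V -> W) t :
  \tsum_(a, b <- t) \sum_i F i a b = \sum_i tlift (F i) t.
Proof.
rewrite /tlift [RHS]exchange_big; apply: eq_bigr => l _ /=.
rewrite [RHS]exchange_big; apply: eq_bigr => m _ /=.
by rewrite scaler_sumr.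
Qed.

Lemma exchange_tlift U V X Y W (E : U -> V -> X -> Y -> W) s t :
  \tsum_(a, b <- s) \tsum_(c, d <- t) E a b c d
  = \tsum_(c, d <- t) \tsum_(a, b <- s) E a b c d.
Proof.
transitivity (\tsum_(a, b <- s) \sum_i \sum_j (t : 'M_(_, _)) i j *:
   E a b (r2v (delta_mx 0 i)) (r2v (delta_mx 0 j))) => //.
rewrite tlift_sum; apply: eq_bigr => i _; rewrite tlift_sum; apply: eq_bigr => j _.
exact/esym/tlift_scaler.
Qed.

Lemma tlift_swap U V W (E : V -> U -> W) t :
  lin2 E -> tlift E (tswap t) = \tsum_(a, b <- t) E b a.
Proof. by move=> E2; rewrite tlift_tlift; apply: eq_tlift => a b; rewrite tlift_tens. Qed.

Lemma tlift_id U V (t : tensor U V) : \tsum_(a, b <- t) (a \ox b) = t.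
Proof.
apply: (eq_tensor (f := tlift (@tens k U V)) (g := id)) => //; first exact: tlift_linear.
by move=> u v; rewrite tlift_tens //; lin.
Qed.

Lemma tswapK U V : cancel (@tswap k U V) (@tswap k V U).
Proof.
by move=> t; rewrite [LHS]tlift_swap ?tlift_id //; lin.
Qed.

Variables A B : falgType k.
Implicit Types s t : tensor A B.

Lemma tliftM W (E : A -> B -> W) s t : lin2 E ->
  tlift E (s * t) = \tsum_(a, b <- s) \tsum_(c, d <- t) E (a * c) (b * d).
Proof.
move=> E2; rewrite [s * t]/(tmul s t) /tmul tlift_tlift.
apply: eq_tlift => a b; rewrite tlift_tlift; apply: eq_tlift => c d.
by rewrite tlift_tens.
Qed.

Lemma tlift1 W (E : A -> B -> W) : lin2 E -> tlift E 1 = E 1 1.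
Proof. by move=> E2; rewrite -tens1 tlift_tens. Qed.

Lemma tswapM s t : tswap (s * t) = tswap s * tswap t.
Proof.
rewrite /tswap tliftM; last lin.
rewrite tlift_mull; apply: eq_tlift => a b.
by rewrite tlift_mulr; apply: eq_tlift => c d; rewrite tensM.
Qed.

Lemma tswap1 : tswap 1 = 1 :> tensor B A.
Proof. by rewrite [LHS]tlift1 ?tens1 //; lin. Qed.

End TLift.

Lemma tswap_inv (k : fieldType) (A B : falgType k) (t : tensor A B) :
  t \is a GRing.unit ->
  tswap t \is a GRing.unit /\ (tswap t)^-1 = tswap t^-1.
Proof.
move=> tu.
have l : tswap t^-1 * tswap t = 1 by rewrite -tswapM mulVr // tswap1.
have r : tswap t * tswap t^-1 = 1 by rewrite -tswapM divrr // tswap1.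
have su : tswap t \is a GRing.unit by apply/unitrP; exists (tswap t^-1).
by split=> //; rewrite -[RHS](mulrK su) l mul1r.
Qed.

(** * Hopf algebras *)

Ltac asc := by intros; rewrite ?mulrA.

Section HopfTheory.
Variables (k : fieldType) (H : falgType k) (A : hopf H).
Local Notation cop := (comul A).
Local Notation eps := (counit A).
Local Notation S := (antipode A).
Local Notation Si := (antipode A)^-1%VF.
Implicit Types (a b h x y : H) (W : lmodType k).

Lemma tlift_coassoc W (E : H -> H -> H -> W) h : lin3 E ->
  \tsum_(a, b <- cop h) \tsum_(a1, a2 <- cop a) E a1 a2 b
    = \tsum_(a, b <- cop h) \tsum_(b1, b2 <- cop b) E a b1 b2.
Proof.
move=> E3; have := congr1 (tlift (fun a t => \tsum_(b, c <- t) E a b c)) (comulA A h).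
rewrite !tlift_tlift => e.
have hE a b c : tlift (fun a t => \tsum_(b, c <- t) E a b c) (a \ox b \ox c) = E a b c.
  by rewrite tlift_tens; last lin; rewrite tlift_tens //; lin.
etransitivity; last (etransitivity; first exact: e);
  by apply: eq_tlift => a b; rewrite tlift_tlift; apply: eq_tlift => c d; rewrite hE.
Qed.

Lemma tlift_counitl W (E : H -> W) h : linear E ->
  \tsum_(a, b <- cop h) ((eps a : k) *: E b) = E h.
Proof.
move=> El; rewrite -[in RHS](counitl A h) (lin_tliftE _ _ El).
by apply: eq_tlift => a b; rewrite -[_ *: b]addr0 El (lin_fun0 El) addr0.
Qed.

Lemma tlift_counitr W (E : H -> W) h : linear E ->
  \tsum_(a, b <- cop h) ((eps b : k) *: E a) = E h.
Proof.
move=> El; rewrite -[in RHS](counitr A h) (lin_tliftE _ _ El).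
by apply: eq_tlift => a b; rewrite -[_ *: a]addr0 El (lin_fun0 El) addr0.
Qed.

Lemma tlift_antipodel W (G : H -> W) (E : H -> H -> W) h : linear G ->
  (forall a b, E a b = G (S a * b)) -> tlift E (cop h) = (eps h : k) *: G 1.
Proof.
move=> Gl EG; under eq_tlift do rewrite EG.
rewrite -(lin_tliftE _ _ Gl) antipodel.
by rewrite -[_ *: 1]addr0 Gl (lin_fun0 Gl) addr0.
Qed.

Lemma tlift_antipoder W (G : H -> W) (E : H -> H -> W) h : linear G ->
  (forall a b, E a b = G (a * S b)) -> tlift E (cop h) = (eps h : k) *: G 1.
Proof.
move=> Gl EG; under eq_tlift do rewrite EG.
rewrite -(lin_tliftE _ _ Gl) antipoder.
by rewrite -[_ *: 1]addr0 Gl (lin_fun0 Gl) addr0.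
Qed.

Lemma tlift_copM W (E : H -> H -> W) x y : lin2 E ->
  \tsum_(a, b <- cop (x * y)) E a b
    = \tsum_(x1, x2 <- cop x) \tsum_(y1, y2 <- cop y) E (x1 * y1) (x2 * y2).
Proof. by move=> E2; rewrite rmorphM tliftM. Qed.

Lemma tlift_cop1 W (E : H -> H -> W) : lin2 E -> tlift E (cop 1) = E 1 1.
Proof. by move=> E2; rewrite rmorph1 tlift1. Qed.

Lemma antipode1 : S 1 = 1.
Proof.
have := antipodel A 1; rewrite tlift_cop1; last lin.
by rewrite mulr1 rmorph1 scale1r.
Qed.

Lemma tlift_copME W (E : H -> H -> W) (F : H -> H -> H -> H -> W) x y : lin2 E ->
  (forall x1 x2 y1 y2, F x1 x2 y1 y2 = E (x1 * y1) (x2 * y2)) ->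
  \tsum_(x1, x2 <- cop x) \tsum_(y1, y2 <- cop y) F x1 x2 y1 y2
  = tlift E (cop (x * y)).
Proof.
move=> E2 FE; rewrite tlift_copM //; apply: eq_tlift => x1 x2.
exact: eq_tlift.
Qed.

(* Both sides are convolution inverses of the product H (x) H -> H. *)
Lemma antipodeM x y : S (x * y) = S y * S x.
Proof.
transitivity (\tsum_(x1, x2 <- cop x) \tsum_(x21, x22 <- cop x2)
  \tsum_(y1, y2 <- cop y) \tsum_(y21, y22 <- cop y2)
    (S (x1 * y1) * (x21 * (y21 * S y22) * S x22))).
  under [RHS]eq_tlift => x1 x2.
    under eq_tlift => x21 x22.
      under eq_tlift => y1 y2.
        rewrite (tlift_antipoder (G := fun z => S (x1 * y1) * (x21 * z * S x22))) //; last lin.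
        over.
      rewrite tlift_counitr; last lin.
      rewrite mulr1.
      over.
    rewrite (tlift_antipoder (G := fun z => S (x1 * y) * z)); [|lin|asc].
    over.
  by rewrite tlift_counitr ?mulr1 //; lin.
(* Regrouped, the first two legs of x and of y meet in S (x1 y1) x2 y2 and cancel. *)
rewrite -tlift_coassoc; last lin.
under eq_tlift => x1 x2.
  under eq_tlift => x11 x12 do (rewrite -tlift_coassoc; last lin).
  rewrite exchange_tlift.
  under eq_tlift => y1 y2.
    rewrite (tlift_copME (E := fun p q => S p * q * (S y2 * S x2))); [|lin|asc].
    rewrite (tlift_antipodel (G := fun z => z * (S y2 * S x2))); [|lin|asc].
    rewrite rmorphM mul1r -scalerA.
    over.
  rewrite -tlift_scaler tlift_counitl; last lin.
  over.
by rewrite tlift_counitl //; lin.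
Qed.

(** In the convolution algebra of maps H -> B, g = g (f g') = (g f) g'. *)
Lemma conv_inv_uniq (B : falgType k) (f g g' : H -> B) :
  linear f -> linear g -> linear g' ->
  (forall h, \tsum_(a, b <- cop h) (g a * f b) = (eps h : k) *: 1) ->
  (forall h, \tsum_(a, b <- cop h) (f a * g' b) = (eps h : k) *: 1) -> g =1 g'.
Proof.
move=> fl gl g'l gf fg' h.
transitivity (\tsum_(a, b <- cop h) \tsum_(b1, b2 <- cop b) (g a * f b1 * g' b2)).
  under eq_tlift => a b.
    under eq_tlift => b1 b2 do rewrite -mulrA.
    rewrite -tlift_mulr fg' -scalerAr mulr1.
    over.
  by rewrite tlift_counitr.
rewrite -tlift_coassoc; last lin.
under eq_tlift => a b do rewrite -tlift_mull gf -scalerAl mul1r.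
exact: tlift_counitl.
Qed.

(** Both sides are convolution inverses of Delta: the left one because Delta is multiplicative, the
    right one because the inner legs cancel, and then the outer ones. *)
Lemma cop_antipode h : cop (S h) = \tsum_(a, b <- cop h) (S b \ox S a).
Proof.
apply: (@conv_inv_uniq (tensor H H) cop (fun h => cop (S h))
  (fun h => \tsum_(a, b <- cop h) (S b \ox S a))); try lin.
- move=> x; under eq_tlift => a b do rewrite -rmorphM.
  by rewrite (tlift_antipodel (G := cop)) // ?rmorph1 //; lin.
move=> x.
transitivity (\tsum_(a, b <- cop x) \tsum_(b1, b2 <- cop b)
  \tsum_(a1, a2 <- cop a) ((a1 * S b2) \ox (a2 * S b1))).
  apply: eq_tlift => a b; rewrite tlift_mulr; apply: eq_tlift => b1 b2.
  rewrite -{1}[cop a]tlift_id tlift_mull; apply: eq_tlift => a1 a2.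
  by rewrite tensM.
rewrite -tlift_coassoc; last lin.
under eq_tlift => a b.
  rewrite tlift_coassoc; last lin.
  under eq_tlift => p q.
    rewrite (tlift_antipoder (G := fun z => (p * S b) \ox z)) //; last lin.
    over.
  rewrite tlift_counitr; last lin.
  over.
by rewrite (tlift_antipoder (G := fun z => z \ox 1)) ?tens1 //; lin.
Qed.
End HopfTheory.
Arguments tlift_coassoc {k H A W E} h _.
Arguments tlift_copM {k H A W E} x y _.
Arguments tlift_copME {k H A W E F} x y _ _.

(** * Integrals and cointegrals *)

Section Integrals.
Variables (k : fieldType) (H : falgType k) (A : hopf H).
Local Notation cop := (comul A).
Local Notation eps := (counit A).
Local Notation S := (antipode A).
Local Notation Si := (antipode A)^-1%VF.
Implicit Types (a b h x y : H) (W : lmodType k).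
Variables (Lam : H) (lam : dual k H).
Hypotheses (LamP : two_sided_integral A Lam) (lamP : right_cointegral A lam)
  (lamLam : lam Lam = 1).

(** The sum S h_1 (h_2 L)_1 (x) (h_2 L)_2 is read in two ways: L absorbs h_2, or S (h_1) h_2 cancels
    and leaves h on the second leg. This and its right-handed version carry elements across the legs
    of Delta L. *)
Lemma integral_antipodel W (E : H -> H -> W) h : lin2 E ->
  \tsum_(a, b <- cop Lam) E (S h * a) b = \tsum_(a, b <- cop Lam) E a (h * b).
Proof.
move=> E2.
transitivity (\tsum_(x, y <- cop h) \tsum_(y1, y2 <- cop y)
   \tsum_(a, b <- cop Lam) E (S x * (y1 * a)) (y2 * b)).
  under [RHS]eq_tlift => x y.
    rewrite (tlift_copME (E := fun a b => E (S x * a) b)) //; last lin.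
    rewrite (LamP y).1 linearZ linearZ /=.
    over.
  by rewrite tlift_counitr //; lin.
rewrite -tlift_coassoc; last lin.
under eq_tlift => x y.
  rewrite (tlift_antipodel (G := fun z => \tsum_(a, b <- cop Lam) E (z * a) (y * b)));
    [|lin|by move=> x1 x2; under eq_tlift do rewrite mulrA].
  over.
rewrite tlift_counitl; last lin.
by under eq_tlift do rewrite mul1r.
Qed.

Lemma integral_antipoder W (E : H -> H -> W) h : lin2 E ->
  \tsum_(a, b <- cop Lam) E (a * h) b = \tsum_(a, b <- cop Lam) E a (b * S h).
Proof.
move=> E2.
transitivity (\tsum_(x, y <- cop h) \tsum_(x1, x2 <- cop x)
   \tsum_(a, b <- cop Lam) E (a * x1) (b * x2 * S y)); last first.
  under eq_tlift => x y.
    rewrite exchange_tlift (tlift_copME (E := fun a b => E a (b * S y))) //; last lin.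
    rewrite (LamP x).2 linearZ linearZ /=.
    over.
  by rewrite tlift_counitl //; lin.
rewrite tlift_coassoc; last lin.
under [RHS]eq_tlift => x y.
  rewrite (tlift_antipoder (G := fun z => \tsum_(a, b <- cop Lam) E (a * x) (b * z)));
    [|lin|by move=> x1 x2; under eq_tlift do rewrite -mulrA].
  over.
rewrite tlift_counitr; last lin.
by under [RHS]eq_tlift do rewrite mulr1.
Qed.

Lemma cointegral_integral : \tsum_(a, b <- cop Lam) ((lam a : k) *: b) = 1.
Proof. by rewrite lamP lamLam scale1r. Qed.

(** Once h has crossed to the second leg, only lam (L_1) L_2 = 1 is left. *)
Lemma integral_dual_basisl h : \tsum_(a, b <- cop Lam) ((lam (S h * a) : k) *: b) = h.
Proof.
rewrite (integral_antipodel (E := fun a b => (lam a : k) *: b)); last lin.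
under eq_tlift do rewrite scalerAr.
by rewrite -tlift_mulr cointegral_integral mulr1.
Qed.

Lemma integral_dual_basisr h : \tsum_(a, b <- cop Lam) ((lam (a * h) : k) *: b) = S h.
Proof.
rewrite (integral_antipoder (E := fun a b => (lam a : k) *: b)); last lin.
under eq_tlift do rewrite scalerAl.
by rewrite -tlift_mull cointegral_integral mul1r.
Qed.

(** The dual bases recover h from S h; in finite dimension this makes [Si] a two-sided inverse. *)
Lemma antipode_inj : injective S.
Proof. by move=> x y Sxy; rewrite -[x]integral_dual_basisl Sxy integral_dual_basisl. Qed.

Lemma antipode_lker : lker S == 0%VS.
Proof. by apply/lker0P; exact: antipode_inj. Qed.

Lemma antipodeK h : Si (S h) = h.
Proof. exact: (lker0_lfunK antipode_lker). Qed.

Lemma antipodeVK h : S (Si h) = h.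
Proof. exact: (lker0_lfunVK antipode_lker). Qed.

(** Expanded in the dual bases, Si L is sum lam (L L_1) L_2, where L absorbs L_1. *)
Lemma antipode_integral : S Lam = Lam.
Proof.
suff e : Si Lam = Lam by rewrite -[in LHS]e antipodeVK.
rewrite -[LHS]integral_dual_basisl antipodeVK.
under eq_tlift => a b do rewrite (LamP a).2 linearZ /=.
under eq_tlift => a b do rewrite lamLam [_ *: 1]mulr1.
exact: counitl.
Qed.
End Integrals.

(** * R-matrices and ribbon elements *)

Section RMatrix.
Variables (k : fieldType) (H : falgType k) (A : hopf H).
Local Notation cop := (comul A).
Local Notation eps := (counit A).
Local Notation S := (antipode A).
Local Notation Si := (antipode A)^-1%VF.
Implicit Types (a b h x y : H) (W : lmodType k).
Hypotheses (SK : cancel S Si) (SVK : cancel Si S).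

Lemma antipodeVM x y : Si (x * y) = Si y * Si x.
Proof. by apply: (can_inj SK); rewrite antipodeM !SVK. Qed.

Lemma antipodeV1 : Si 1 = 1.
Proof. by apply: (can_inj SK); rewrite SVK antipode1. Qed.

Lemma cop_antipodeV h : cop (Si h) = \tsum_(a, b <- cop h) (Si b \ox Si a).
Proof.
rewrite -{2}[h]SVK cop_antipode tlift_tlift -[LHS]tlift_id.
apply: eq_tlift => a b; rewrite tlift_tens ?SK //; lin.
Qed.

Lemma tlift_antipodeV W (G : H -> W) (E : H -> H -> W) h : linear G ->
  (forall a b, E a b = G (b * Si a)) -> tlift E (cop h) = (eps h : k) *: G 1.
Proof.
move=> Gl EG; rewrite -antipodeV1.
apply: (tlift_antipoder (G := fun z => G (Si z))); first lin.
by move=> a b; rewrite EG antipodeVM SK.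
Qed.

Variable R : tensor H H.
Hypothesis qtR : quasitriangular A R.

Lemma R_unit : R \is a GRing.unit. Proof. by case: qtR. Qed.

Lemma tlift_Rcopl W (E : H -> H -> H -> W) : lin3 E ->
  \tsum_(a, b <- R) \tsum_(a1, a2 <- cop a) E a1 a2 b
  = \tsum_(r, s <- R) \tsum_(r', s' <- R) E r r' (s * s').
Proof.
move=> E3; case: qtR => _ _ RD _.
have E2 : lin2 (fun a (t : tensor H H) => \tsum_(b, c <- t) E a b c) by lin.
have e a b c : tlift (fun a t => \tsum_(b, c <- t) E a b c) (a \ox b \ox c) = E a b c.
  by rewrite tlift_tens // tlift_tens //; lin.
have := congr1 (tlift (fun a t => \tsum_(b, c <- t) E a b c)) RD.
rewrite tliftM // !tlift_tlift => {}RD.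
transitivity (\tsum_(a, b <- R) tlift (fun a t => \tsum_(b, c <- t) E a b c)
   (\tsum_(a1, a2 <- cop a) (a1 \ox a2 \ox b))).
  by apply: eq_tlift => a b; rewrite tlift_tlift; apply: eq_tlift => c d.
rewrite {}RD; apply: eq_tlift => r s; rewrite tlift_tens; last lin.
rewrite tlift_tlift; apply: eq_tlift => r' s'.
rewrite tlift_tens; last lin.
by rewrite tensM tlift_tens ?mulr1 ?mul1r //; lin.
Qed.

Lemma tlift_Rcopr W (E : H -> H -> H -> W) : lin3 E ->
  \tsum_(a, b <- R) \tsum_(b1, b2 <- cop b) E a b1 b2
  = \tsum_(r, s <- R) \tsum_(r', s' <- R) E (r * r') s' s.
Proof.
move=> E3; case: qtR => _ _ _ RD.
have E2 : lin2 (fun a (t : tensor H H) => \tsum_(b, c <- t) E a b c) by lin.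
have := congr1 (tlift (fun a t => \tsum_(b, c <- t) E a b c)) RD.
rewrite tliftM // !tlift_tlift => {}RD.
transitivity (\tsum_(a, b <- R) tlift (fun a t => \tsum_(b, c <- t) E a b c)
   (a \ox cop b)).
  by apply: eq_tlift => a b; rewrite tlift_tens.
rewrite {}RD; apply: eq_tlift => r s; rewrite tlift_tens; last lin.
rewrite tlift_tlift; apply: eq_tlift => r' s'.
rewrite tlift_tens; last lin.
by rewrite tensM tlift_tens ?mulr1 ?mul1r //; lin.
Qed.

Lemma R_cop W (E : H -> H -> W) h : lin2 E ->
  \tsum_(a, b <- cop h) \tsum_(r, s <- R) E (b * r) (a * s)
  = \tsum_(r, s <- R) \tsum_(a, b <- cop h) E (r * a) (s * b).
Proof.
move=> E2; case: qtR => Ru Rc _ _.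
have := congr1 (fun t => tlift E (t * R)) (Rc h).
rewrite /= mulrVK // !tliftM // => <-.
by rewrite tlift_swap //; lin.
Qed.

(** Applying eps to the first leg of (Delta (x) id) R = R_13 R_23 gives R = (1 (x) x) R with x the
    sum in question, and R can be cancelled. *)
Lemma R_counitl : \tsum_(r, s <- R) ((eps r : k) *: s) = 1.
Proof.
have e : (1 \ox (\tsum_(r, s <- R) ((eps r : k) *: s))) * R = R.
  rewrite -[in RHS](tlift_id R).
  transitivity (\tsum_(a, b <- R) \tsum_(a1, a2 <- cop a) ((eps a1 : k) *: (a2 \ox b))).
    rewrite tlift_Rcopl; last lin.
    rewrite (lin_tliftE (f := fun z => (1 \ox z) * R)); last lin.
    apply: eq_tlift => r s; rewrite -{1}[R]tlift_id tlift_mulr.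
    apply: eq_tlift => r' s'; rewrite tensM mul1r -scalerAl.
    exact: (lin_funZ (f := tens _) _ _ (tens_linr _)).
  by apply: eq_tlift => a b; rewrite tlift_counitl //; lin.
have /(congr1 (tlift (fun a b => (eps a : k) *: b))) :
    1 \ox (\tsum_(r, s <- R) ((eps r : k) *: s)) = 1 :> tensor H H.
  by rewrite -[LHS](mulrK R_unit) e divrr // R_unit.
by rewrite tlift1 ?tlift_tens; try lin; rewrite rmorph1 !scale1r.
Qed.

Lemma R_invl : R^-1 = \tsum_(r, s <- R) (S r \ox s).
Proof.
rewrite -[RHS](mulrK R_unit) -[LHS]mul1r; congr (_ * _).
rewrite -[X in _ * X]tlift_id tlift_mull.
transitivity (\tsum_(r, s <- R) \tsum_(r', s' <- R) ((S r * r') \ox (s * s'))).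
  rewrite -(tlift_Rcopl (E := fun a1 a2 b => (S a1 * a2) \ox b)); last lin.
  under eq_tlift => a b.
    rewrite (tlift_antipodel (G := fun z => z \ox b)) //; last lin.
    over.
  rewrite -[LHS]tens1 -[X in 1 \ox X]R_counitl.
  rewrite (lin_tliftE (f := tens 1) _ _ (tens_linr _)).
  by apply: eq_tlift => a b; rewrite (lin_funZ _ _ (tens_linr _)).
apply: eq_tlift => r s; rewrite tlift_mulr; apply: eq_tlift => r' s'.
by rewrite tensM.
Qed.

Lemma tlift_R_invl W (E : H -> H -> W) : lin2 E ->
  tlift E R^-1 = \tsum_(r, s <- R) E (S r) s.
Proof.
by move=> E2; rewrite R_invl tlift_tlift; apply: eq_tlift => r s; rewrite tlift_tens.
Qed.

Lemma R_counitr : \tsum_(r, s <- R) ((eps s : k) *: r) = 1.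
Proof.
have e : ((\tsum_(r, s <- R) ((eps s : k) *: r)) \ox 1) * R = R.
  rewrite -[in RHS](tlift_id R).
  transitivity (\tsum_(a, b <- R) \tsum_(b1, b2 <- cop b) ((eps b2 : k) *: (a \ox b1))).
    rewrite tlift_Rcopr; last lin.
    rewrite (lin_tliftE (f := fun z => (z \ox 1) * R)); last lin.
    apply: eq_tlift => r s; rewrite -{1}[R]tlift_id tlift_mulr.
    apply: eq_tlift => r' s'; rewrite tensM mul1r -scalerAl.
    by rewrite (lin_funZ (f := fun z => z \ox s')) //; lin.
  by apply: eq_tlift => a b; rewrite tlift_counitr //; lin.
have /(congr1 (tlift (fun a b => (eps b : k) *: a))) :
    (\tsum_(r, s <- R) ((eps s : k) *: r)) \ox 1 = 1 :> tensor H H.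
  by rewrite -[LHS](mulrK R_unit) e divrr // R_unit.
by rewrite tlift1 ?tlift_tens; try lin; rewrite rmorph1 !scale1r.
Qed.

(** Here S^-1 replaces S because (id (x) Delta) R = R_13 R_12 lists the second legs in reversed
    order. *)
Lemma R_invr : R^-1 = \tsum_(r, s <- R) (r \ox Si s).
Proof.
rewrite -[RHS](mulrK R_unit) -[LHS]mul1r; congr (_ * _).
rewrite -[X in _ * X]tlift_id tlift_mull.
transitivity (\tsum_(r, s <- R) \tsum_(r', s' <- R) ((r * r') \ox (Si s * s'))).
  rewrite -(tlift_Rcopr (E := fun a b1 b2 => a \ox (Si b2 * b1))); last lin.
  under eq_tlift => a b.
    rewrite (tlift_antipodel (G := fun z => a \ox Si z)); [|lin|]; last first.
      by move=> b1 b2; rewrite antipodeVM SK.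
    rewrite antipodeV1.
    over.
  rewrite -[LHS]tens1 -[X in X \ox 1]R_counitr.
  rewrite (lin_tliftE (f := fun z => z \ox 1)); last lin.
  by apply: eq_tlift => a b; rewrite (lin_funZ (f := fun z => z \ox 1)) //; lin.
apply: eq_tlift => r s; rewrite tlift_mulr; apply: eq_tlift => r' s'.
by rewrite tensM.
Qed.

Lemma tlift_R_invr W (E : H -> H -> W) : lin2 E ->
  tlift E R^-1 = \tsum_(r, s <- R) E r (Si s).
Proof.
by move=> E2; rewrite R_invr tlift_tlift; apply: eq_tlift => r s; rewrite tlift_tens.
Qed.

Lemma R_antipode W (E : H -> H -> W) : lin2 E ->
  \tsum_(r, s <- R) E (S r) (S s) = tlift E R.
Proof.
move=> E2; rewrite -(tlift_R_invl (E := fun a b => E a (S b))); last lin.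
rewrite tlift_R_invr; last lin.
by apply: eq_tlift => r s; rewrite SVK.
Qed.

(** * The Drinfeld element *)

Local Notation u := (drinfeld_element A R).

(** The sum S^2 h_3 S (s h_2) r h_1 is evaluated twice. As it stands, S (h_2 S h_3) cancels and u h
    remains; after R Delta = Delta^op R it is S^2 h_3 S (h_1 s) h_2 r, where S (h_1) h_2 cancels. *)
Lemma drinfeld_antipode2 h : u * h = S (S h) * u.
Proof.
pose E a b c := S (S c) * S b * a.
transitivity (\tsum_(x, z <- cop h) \tsum_(a, b <- cop x) \tsum_(r, s <- R)
   (S (S z) * S (s * b) * (r * a))).
  rewrite tlift_coassoc; last lin.
  under [RHS]eq_tlift => a b.
    rewrite exchange_tlift.
    under eq_tlift => r s.
      rewrite (tlift_antipoder (G := fun z => S z * S s * (r * a))); [|lin|]; last first.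
        by move=> x y; rewrite !antipodeM !mulrA.
      rewrite antipode1 mul1r.
      over.
    rewrite -tlift_scaler.
    over.
  rewrite tlift_counitr; last lin.
  by rewrite tlift_mull; apply: eq_tlift => r s; rewrite mulrA.
under eq_tlift => x z.
  rewrite exchange_tlift.
  rewrite -(R_cop (E := fun p q => S (S z) * S q * p)); last lin.
  over.
under eq_tlift => x z.
  under eq_tlift => a b do under eq_tlift => r s do rewrite antipodeM.
  rewrite exchange_tlift.
  under eq_tlift => r s.
    rewrite (tlift_antipodel (G := fun w => S (S z) * S s * w * r)); [|lin|asc].
    rewrite mulr1.
    over.
  rewrite -tlift_scaler.
  over.
rewrite tlift_counitl; last lin.
by rewrite tlift_mulr; apply: eq_tlift => r s; rewrite mulrA.
Qed.

(** Pushing u past s gives sum S^2 s S s' r' S^2 r. Two uses of (S (x) S) R = R lower this to sum s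
    S s' r' r, which is the sum of S (b) a over a (x) b = R R^-1. *)
Lemma drinfeld_mul_inv : u * (\tsum_(r, s <- R) (s * S (S r))) = 1.
Proof.
transitivity (\tsum_(r', s' <- R) \tsum_(r, s <- R) (S (s' * Si s) * (r' * r))).
  under [RHS]eq_tlift => r' s'.
    under eq_tlift => r s do rewrite antipodeM SVK.
    rewrite -(R_antipode (E := fun r s => s * S s' * (r' * r))); last lin.
    rewrite -(R_antipode (E := fun r s => S s * S s' * (r' * S r))); last lin.
    over.
  rewrite exchange_tlift tlift_mulr; apply: eq_tlift => r s.
  rewrite mulrA drinfeld_antipode2 !(tlift_mull, tlift_mulr); apply: eq_tlift => r' s'.
  by rewrite !mulrA.
transitivity (tlift (fun a b => S b * a) (R * R^-1)).
  rewrite tliftM; last lin.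
  by apply: eq_tlift => r' s'; rewrite tlift_R_invr //; lin.
by rewrite divrr ?R_unit // tlift1 ?antipode1 ?mulr1 //; lin.
Qed.

Lemma drinfeld_unit : u \is a GRing.unit.
Proof.
apply/unitrP; pose w := \tsum_(r, s <- R) (s * S (S r)).
exists w; split; last exact: drinfeld_mul_inv.
(* Since S^2 w u = u w, S^2 w is a left inverse of u and must agree with the right inverse w. *)
have e : S (S w) * u = 1 by rewrite -drinfeld_antipode2 drinfeld_mul_inv.
by rewrite -[w]mul1r -{1}e -[_ * u * w]mulrA drinfeld_mul_inv mulr1 e.
Qed.

Lemma drinfeld_inv : u^-1 = \tsum_(r, s <- R) (s * S (S r)).
Proof. by rewrite -[RHS](mulKr drinfeld_unit) drinfeld_mul_inv mulr1. Qed.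

Lemma antipode_drinfeld : S u = \tsum_(r, s <- R) (r * S s).
Proof.
rewrite lfun_tlift -(R_antipode (E := fun r s => r * S s)); last lin.
by apply: eq_tlift => r s; rewrite antipodeM.
Qed.

Lemma antipodeV_unit x : x \is a GRing.unit -> S x^-1 * S x = 1 /\ S x * S x^-1 = 1.
Proof. by move=> xu; rewrite -!antipodeM divrr // mulVr // antipode1. Qed.

Lemma antipode_unit x : x \is a GRing.unit -> S x \is a GRing.unit.
Proof. by move=> /antipodeV_unit[l r]; apply/unitrP; exists (S x^-1). Qed.

Lemma antipode_inv x : x \is a GRing.unit -> S x^-1 = (S x)^-1.
Proof.
move=> xu; have [l _] := antipodeV_unit xu.
by rewrite -[LHS](mulrK (antipode_unit xu)) l mul1r.
Qed.

Lemma antipode_drinfeld_inv : (S u)^-1 = \tsum_(r, s <- R) (S (S r) * s).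
Proof.
rewrite -antipode_inv ?drinfeld_unit // drinfeld_inv lfun_tlift.
rewrite -(R_antipode (E := fun r s => S (S r) * s)); last lin.
by apply: eq_tlift => r s; rewrite antipodeM.
Qed.

Lemma antipode_drinfeld_antipode2 h : S (S h) * (S u)^-1 = (S u)^-1 * h.
Proof.
have Suu : S u \is a GRing.unit := antipode_unit drinfeld_unit.
have := congr1 S (drinfeld_antipode2 (Si h)); rewrite !antipodeM SVK => e.
by rewrite -[h in RHS](mulrK Suu) e !mulrA mulVr // mul1r.
Qed.

(** * The monodromy matrix *)

Local Notation Q := (monodromy R).

Lemma Q_inv : Q^-1 = R^-1 * tswap R^-1.
Proof.
have [su sV] := tswap_inv R_unit.
by rewrite -sV invrM ?R_unit.
Qed.

Lemma tlift_Q W (E : H -> H -> W) : lin2 E ->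
  tlift E Q = \tsum_(r, s <- R) \tsum_(r', s' <- R) E (s * r') (r * s').
Proof. by move=> E2; rewrite tliftM // tlift_swap //; lin. Qed.

Lemma tlift_Qinv W (E : H -> H -> W) : lin2 E ->
  tlift E Q^-1
  = \tsum_(a, b <- R^-1) \tsum_(r, s <- R) E (a * s) (b * S r).
Proof.
move=> E2; rewrite Q_inv tliftM //; apply: eq_tlift => a b.
by rewrite tlift_swap ?tlift_R_invl //; lin.
Qed.

Lemma Q_antipode W (E : H -> H -> W) : lin2 E ->
  \tsum_(a, b <- Q) E (S b) (S a) = tlift E Q.
Proof.
move=> E2; rewrite !tlift_Q; [|lin|lin].
rewrite [RHS]exchange_tlift.
rewrite -[RHS]R_antipode; last lin.
apply: eq_tlift => r s; rewrite -[RHS]R_antipode; last lin.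
by apply: eq_tlift => r' s'; rewrite !antipodeM.
Qed.

Lemma Q_cop h : Q * cop h = cop h * Q.
Proof.
case: qtR => Ru Rc _ _.
have e : R * cop h = tswap (cop h) * R by rewrite Rc mulrVK.
have e' : tswap R * tswap (cop h) = cop h * tswap R.
  by rewrite -[cop h in RHS]tswapK -!tswapM e.
by rewrite /monodromy -mulrA e !mulrA e'.
Qed.

Lemma Qinv_cop h : Q^-1 * cop h = cop h * Q^-1.
Proof. exact/esym/commrV/esym/Q_cop. Qed.

(** * The ribbon element and the balancing element *)

Variable v : H.
Hypothesis ribv : ribbon A R v.

Lemma ribbon_unit : v \is a GRing.unit. Proof. by case: ribv. Qed.
Lemma ribbon_central h : v * h = h * v. Proof. by case: ribv. Qed.
Lemma ribbon_antipode : S v = v. Proof. by case: ribv. Qed.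

Lemma ribbonV_central h : v^-1 * h = h * v^-1.
Proof. exact/esym/commrV/esym/ribbon_central. Qed.

(** Contracting Delta v = (v (x) v) Q^-1 by S (a) b gives eps v = 1 on one side; on the other, the
    two copies of R in Q^-1 sum to u^-1 and (S u)^-1, with v^2 in front. *)
Lemma ribbon_sqr : v * v = S u * u.
Proof.
case: ribv => vu vC Sv ev Dv.
have uu := drinfeld_unit; have Suu := antipode_unit uu.
have e r' s' : \tsum_(r, s <- R) (S (v * (S r * s')) * (v * (s * S r')))
    = v * v * (S s' * S (S (S r'))) * (S u)^-1.
  rewrite -!mulrA antipode_drinfeld_antipode2 antipode_drinfeld_inv.
  rewrite !(tlift_mulr, tlift_mull); apply: eq_tlift => r s.
  by rewrite !antipodeM Sv !mulrA -!vC !mulrA.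
have := antipodel A v; rewrite ev scale1r Dv tliftM; last lin.
rewrite tlift_tens; last lin.
rewrite tlift_Qinv; last lin.
rewrite tlift_R_invl; last lin.
rewrite exchange_tlift; under eq_tlift do rewrite e.
rewrite -tlift_mull -tlift_mulr (R_antipode (E := fun r s => s * S (S r))); last lin.
rewrite -drinfeld_inv => e1.
by rewrite -[LHS](mulrVK uu) -[v * v / u](mulrVK Suu) e1 mul1r.
Qed.

Local Notation t := (balancing A R v).

Lemma balancing_unit : t \is a GRing.unit.
Proof. by rewrite unitrMr ?drinfeld_unit // unitrV ribbon_unit. Qed.

Lemma balancing_antipode2 h : t * h = S (S h) * t.
Proof. by rewrite -mulrA ribbonV_central mulrA drinfeld_antipode2 mulrA. Qed.

Lemma antipode_balancing : S t = t^-1.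
Proof.
have vu := ribbon_unit; have uu := drinfeld_unit.
rewrite antipodeM antipode_inv // ribbon_antipode invrM ?unitrV // invrK.
by rewrite -[S u](mulrK uu) -ribbon_sqr mulrA mulKr.
Qed.

Lemma antipodeV_balancing : Si t = t^-1.
Proof.
by apply: (can_inj SK); rewrite SVK antipode_inv ?balancing_unit // antipode_balancing invrK.
Qed.

End RMatrix.
Arguments tlift_Q {k H R W E} _.

(** * Integrals in ribbon Hopf algebras *)

Section RibbonIntegrals.
Variables (k : fieldType) (H : falgType k) (A : hopf H).
Local Notation cop := (comul A).
Local Notation eps := (counit A).
Local Notation S := (antipode A).
Local Notation Si := (antipode A)^-1%VF.
Implicit Types (a b h x y : H) (W : lmodType k).
Variables (R : tensor H H) (v Lam : H) (lam : dual k H).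
Hypotheses (qtR : quasitriangular A R) (ribv : ribbon A R v).
Hypotheses (LamP : two_sided_integral A Lam) (lamP : right_cointegral A lam)
  (lamLam : lam Lam = 1)
  (lamQ : \tsum_(a, b <- monodromy R) ((lam a : k) *: b) = Lam).
Local Notation u := (drinfeld_element A R).
Local Notation t := (balancing A R v).
Local Notation Q := (monodromy R).

Let SK : cancel S Si := antipodeK LamP lamP lamLam.
Let SVK : cancel Si S := antipodeVK LamP lamP lamLam.
Let tu : t \is a GRing.unit := balancing_unit SK SVK qtR ribv.
Let tS : S t = t^-1 := antipode_balancing SK SVK qtR ribv.

(** L_2 (x) L_1 = R (L_1 (x) L_2) R^-1. Moving the second leg of R to the first gives S u on the
    left of L_1, moving the first leg of R^-1 to the second gives (S u)^-1 on the right of L_2, and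
    the latter crosses back as u^-1. Finally S u = v^2 u^-1 with v central. *)
Lemma integral_swap W (E : H -> H -> W) : lin2 E ->
  \tsum_(a, b <- cop Lam) E b a = \tsum_(a, b <- cop Lam) E (t^-1 * a * t^-1) b.
Proof.
move=> E2; have Ru := R_unit qtR.
transitivity (\tsum_(a, b <- cop Lam) \tsum_(r, s <- R)
   \tsum_(c, d <- R^-1) E (b * r * c) (a * s * d)).
  apply: eq_tlift => a b.
  transitivity (tlift (fun x y => E (b * x) (a * y)) (R * R^-1)).
    by rewrite divrr // tlift1 ?mulr1 //; lin.
  rewrite tliftM; last lin.
  by apply: eq_tlift => r s; apply: eq_tlift => c d; rewrite !mulrA.
rewrite (R_cop qtR (E := fun p q => \tsum_(c, d <- R^-1) E (p * c) (q * d))); last lin.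
transitivity (\tsum_(a, b <- cop Lam) E (S u * a) (b * (S u)^-1)).
  rewrite antipode_drinfeld_inv // antipode_drinfeld //.
  under [RHS]eq_tlift => a b.
    rewrite (lin_tliftE (f := fun z => E (z * a) _)); last lin.
    under eq_tlift => r s.
      rewrite tlift_mulr (lin_tliftE (f := fun z => E _ z)); last lin.
      over.
    over.
  rewrite [RHS]exchange_tlift; apply: eq_tlift => r s.
  under eq_tlift => a b do (rewrite (tlift_R_invl qtR); last lin).
  rewrite exchange_tlift [RHS]exchange_tlift; apply: eq_tlift => r' s'.
  transitivity (\tsum_(a, b <- cop Lam) E (r * (S s * a) * S r') (b * s')).
    rewrite (integral_antipodel LamP (E := fun a b => E (r * a * S r') (b * s'))); last lin.
    by apply: eq_tlift => a b; rewrite ?mulrA.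
  transitivity (\tsum_(a, b <- cop Lam) E (r * (S s * (a * S r'))) (b * s')).
    by apply: eq_tlift => a b; rewrite !mulrA.
  rewrite (integral_antipoder LamP (E := fun a b => E (r * (S s * a)) (b * s'))); last lin.
  by apply: eq_tlift => a b; rewrite !mulrA.
have uu := drinfeld_unit SK SVK qtR.
rewrite -antipode_inv // -(integral_antipoder LamP (E := fun a b => E (S u * a) b)); last lin.
apply: eq_tlift => a b; congr (E _ b).
have vu := ribbon_unit ribv; have vC := ribbon_central ribv.
rewrite invrM ?unitrV // invrK -[S u](mulrK uu) -(ribbon_sqr SK SVK qtR ribv).
by rewrite [RHS]mulrA -(vC (_ * _ * _)) !mulrA.
Qed.

Lemma integral_cointegral_swap : \tsum_(a, b <- cop Lam) ((lam b : k) *: a) = t * t.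
Proof.
rewrite (integral_swap (E := fun a b => (lam a : k) *: b)); last lin.
under eq_tlift do rewrite -tS.
rewrite (integral_antipodel LamP (E := fun a b => (lam (a * S t) : k) *: b)); last lin.
under eq_tlift do rewrite scalerAr.
by rewrite -tlift_mulr integral_dual_basisr // tS antipode_inv // tS invrK.
Qed.

Lemma integral_surjl x : exists h,
  x = \tsum_(a, b <- cop Lam) ((lam (h * b) : k) *: a).
Proof.
(* Moving h to the first leg turns the sum into S h t^2, and S h t^2 = x is solved for h. *)
exists (Si (x * t^-1 * t^-1)).
rewrite -(integral_antipodel LamP (E := fun a b => (lam b : k) *: a)); last lin.
under eq_tlift do rewrite scalerAr.
by rewrite -tlift_mulr integral_cointegral_swap SVK mulrA !mulrVK.
Qed.

Lemma integral_nondeg (f g : H -> k^o) : linear f -> linear g ->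
  \tsum_(a, b <- cop Lam) ((f a : k) *: b) = \tsum_(a, b <- cop Lam) ((g a : k) *: b) ->
  f =1 g.
Proof.
have e (f' : H -> k^o) h : linear f' ->
    f' (\tsum_(a, b <- cop Lam) ((lam (h * b) : k) *: a))
    = lam (h * \tsum_(a, b <- cop Lam) ((f' a : k) *: b)).
  move=> fl; rewrite (lin_tliftE _ _ fl) tlift_mulr lfun_tlift.
  apply: eq_tlift => a b; rewrite (lin_funZ _ _ fl) -scalerAr linearZ /=.
  exact: mulrC.
by move=> fl gl fg x; have [h ->] := integral_surjl x; rewrite !e // fg.
Qed.

(** As functionals of x, both sides contracted with L_1 leave S y on the second leg. *)
Lemma cointegralM x y : lam (x * y) = lam (S (S y) * x).
Proof.
apply: (integral_nondeg (f := fun x => lam (x * y)) (g := fun x => lam (S (S y) * x)));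
  [lin|lin|].
by rewrite integral_dual_basisr // integral_dual_basisl.
Qed.

(** Contracted with L_1, the right side leaves t^-2. Applying S to the left contraction and using S
    L = L gives sum lam (L_2) L_1 = t^2 = S (t^-2). *)
Lemma cointegral_antipode x : lam (S x) = lam (t * t * x).
Proof.
apply: (integral_nondeg (f := fun x => lam (S x)) (g := fun x => lam (t * t * x)));
  [lin|lin|].
have -> : t * t = S (t^-1 * t^-1) by rewrite antipodeM antipode_inv // tS invrK.
rewrite integral_dual_basisl //; apply: (can_inj SK).
rewrite antipodeM antipode_inv // tS invrK -integral_cointegral_swap.
rewrite -[in RHS](antipode_integral LamP lamP lamLam) cop_antipode tlift_tlift lfun_tlift.
by apply: eq_tlift => a b; rewrite linearZ /= tlift_tens //; lin.
Qed.

(* This is the only place where the normalization of lam and Lam against the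
   monodromy matrix enters. *)
Lemma integral_monodromy W (E : H -> H -> W) : lin2 E ->
  tlift E (cop Lam) = \tsum_(p, p' <- Q^-1) \tsum_(q, q' <- Q)
    ((lam (S p' * q) : k) *: E p q').
Proof.
move=> E2.
transitivity (\tsum_(q, q' <- Q) ((lam q : k) *: tlift E (cop q'))).
  rewrite -{1}lamQ (lin_tliftE (f := fun z => tlift E (cop z))); last lin.
  by apply: eq_tlift => q q'; rewrite linearZ linearZ.
rewrite (tlift_Q (E := fun q q' => (lam q : k) *: tlift E (cop q'))); last lin.
transitivity (\tsum_(r, s <- R) \tsum_(r1, r2 <- cop r) \tsum_(r', s' <- R)
   \tsum_(s1, s2 <- cop s') ((lam (s * r') : k) *: E (r1 * s1) (r2 * s2))).
  apply: eq_tlift => r s; rewrite [RHS]exchange_tlift; apply: eq_tlift => r' s'.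
  rewrite tlift_copM // tlift_scaler; apply: eq_tlift => r1 r2.
  by rewrite tlift_scaler.
rewrite (tlift_Rcopl qtR); last lin.
rewrite (tlift_Qinv qtR); last lin.
rewrite (tlift_R_invr SK SVK qtR); last lin.
apply: eq_tlift => r s.
(* The two hexagon identities turn lam (s r') into lam (s s'' r' r3). Rotating r3 to the front by
   [cointegralM] pairs it with s, which forms Q^-1, and leaves s'' r' for Q. *)
transitivity (\tsum_(r'', s'' <- R) \tsum_(r', s' <- R) \tsum_(r3, s3 <- R)
   ((lam (S (Si s * S r3) * (s'' * r')) : k) *: E (r * s3) (r'' * s'))).
  apply: eq_tlift => r'' s''.
  rewrite (tlift_Rcopr qtR); last lin.
  apply: eq_tlift => r' s'; apply: eq_tlift => r3 s3.
  by rewrite mulrA cointegralM antipodeM SVK !mulrA.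
under eq_tlift do rewrite exchange_tlift.
rewrite exchange_tlift; apply: eq_tlift => r3 s3.
by rewrite tlift_Q //; lin.
Qed.

(** Expand lam (S z_2 y) 1 by the cointegral property; then z_1 S z_2 cancels. It moves the
    coproduct in Delta_F from x to y, which exposes the rank-one shape. *)
Lemma cointegral_antipode_cop z y :
  \tsum_(z1, z2 <- cop z) ((lam (S z2 * y) : k) *: z1)
  = \tsum_(y1, y2 <- cop y) ((lam (S z * y1) : k) *: y2).
Proof.
transitivity (\tsum_(z1, z2 <- cop z) \tsum_(a, b <- cop z2) \tsum_(y1, y2 <- cop y)
   ((lam (S b * y1) : k) *: (z1 * S a * y2))).
  apply: eq_tlift => z1 z2.
  transitivity (z1 * ((lam (S z2 * y) : k) *: 1)); first by rewrite -scalerAr mulr1.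
  rewrite -lamP tlift_copM; last lin.
  rewrite cop_antipode tlift_tlift tlift_mulr; apply: eq_tlift => a b.
  rewrite tlift_tens; last lin.
  by rewrite tlift_mulr; apply: eq_tlift => y1 y2; rewrite -scalerAr mulrA.
rewrite -tlift_coassoc; last lin.
under eq_tlift => x b.
  rewrite (tlift_antipoder (G := fun w => \tsum_(y1, y2 <- cop y)
     ((lam (S b * y1) : k) *: (w * y2)))) //; last lin.
  over.
rewrite tlift_counitl; last lin.
by apply: eq_tlift => y1 y2; rewrite mul1r.
Qed.

(** On the right, Q^-1 commutes past y_2 (x) y_3, after which y_2 S^-1 y_1 cancels. *)
Lemma Qinv_cop_adjoint W (E : H -> H -> H -> W) y : lin3 E ->
  \tsum_(p, p' <- Q^-1) \tsum_(y1, y2 <- cop y) E p (p' * y1) y2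
  = \tsum_(p, p' <- Q^-1) \tsum_(y1, w <- cop y) \tsum_(y2, w' <- cop w)
    \tsum_(y3, y4 <- cop w') E (y2 * p * Si y1) (y3 * p') y4.
Proof.
move=> E3.
transitivity (\tsum_(y1, w <- cop y) \tsum_(z, y4 <- cop w) \tsum_(y2, y3 <- cop z)
   \tsum_(p, p' <- Q^-1) E (y2 * p * Si y1) (y3 * p') y4); last first.
  rewrite [RHS]exchange_tlift; apply: eq_tlift => y1 w.
  rewrite tlift_coassoc; last lin.
  rewrite [RHS]exchange_tlift; apply: eq_tlift => y2 w'.
  by rewrite [RHS]exchange_tlift.
have Qc a b z : \tsum_(y2, y3 <- cop z) \tsum_(p, p' <- Q^-1) E (y2 * p * a) (y3 * p') b
   = \tsum_(p, p' <- Q^-1) \tsum_(y2, y3 <- cop z) E (p * y2 * a) (p' * y3) b.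
  rewrite -(tliftM (E := fun x y => E (x * a) y b)); last lin.
  by rewrite -(Qinv_cop qtR) tliftM //; lin.
under [RHS]eq_tlift => y1 w do under eq_tlift => z y4 do rewrite Qc.
rewrite -tlift_coassoc; last lin.
rewrite exchange_tlift; apply: eq_tlift => x y4.
rewrite [RHS]exchange_tlift; apply: eq_tlift => p p'.
rewrite -tlift_coassoc; last lin.
under [RHS]eq_tlift => z y3.
  rewrite (tlift_antipodeV SK SVK (G := fun w => E (p * w) (p' * y3) y4)); [|lin|asc].
  rewrite mulr1.
  over.
by rewrite tlift_counitl //; lin.
Qed.

(** In the adjoint form of Q^-1 the argument of lam contains S (y_3 p') y_4, so y leaves lam
    altogether. With Q rewritten as S q' (x) S q, what remains is the expression of Delta L through
    Q. *)
Lemma Qinv_Q_integral W (E : H -> H -> W) y : lin2 E ->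
  \tsum_(p, p' <- Q^-1) \tsum_(q, q' <- Q) \tsum_(y1, y2 <- cop y)
     ((lam (S (p' * y1) * y2 * Si q') : k) *: E p q)
  = \tsum_(y1, y2 <- cop y) \tsum_(a, b <- cop Lam) E (y2 * a * Si y1) (S b).
Proof.
move=> E2; rewrite exchange_tlift.
transitivity (\tsum_(q, q' <- Q) \tsum_(p, p' <- Q^-1) \tsum_(y1, y2 <- cop y)
   ((lam (S p' * Si q') : k) *: E (y2 * p * Si y1) q)).
  apply: eq_tlift => q q'.
  rewrite (Qinv_cop_adjoint (E := fun p p' y2 => (lam (S p' * y2 * Si q') : k) *: E p q));
    last lin.
  apply: eq_tlift => p p'; apply: eq_tlift => y1 w.
  under eq_tlift => y2 w'.
    rewrite (tlift_antipodel (G := fun z => (lam (S p' * z * Si q') : k)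
      *: E (y2 * p * Si y1) q)); [|lin|]; last first.
      by move=> a b; rewrite antipodeM !mulrA.
    rewrite mulr1.
    over.
  by rewrite tlift_counitr //; lin.
rewrite exchange_tlift.
under eq_tlift => p p' do rewrite exchange_tlift.
rewrite exchange_tlift; apply: eq_tlift => y1 y2.
rewrite (integral_monodromy (E := fun a b => E (y2 * a * Si y1) (S b))); last lin.
apply: eq_tlift => p p'; rewrite -(Q_antipode SK SVK qtR); last lin.
by apply: eq_tlift => q q'; rewrite SK.
Qed.

(** Carrying y_2, and in the next lemma y_1, across L gives the same sum with y acting on the first
    leg, on both legs, or on the second leg only. *)
Lemma adjoint_integral_left W (E : H -> H -> W) y : lin2 E ->
  \tsum_(y1, y2 <- cop y) \tsum_(a, b <- cop Lam) E (y2 * a * Si y1) (S b)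
  = \tsum_(y1, y2 <- cop y) \tsum_(a, b <- cop Lam) E (a * Si y1) (S b * y2).
Proof.
move=> E2; apply: eq_tlift => y1 y2.
transitivity (\tsum_(a, b <- cop Lam) E (S (Si y2) * a * Si y1) (S b)).
  by rewrite SVK.
rewrite (integral_antipodel LamP (E := fun a b => E (a * Si y1) (S b))); last lin.
by apply: eq_tlift => a b; rewrite antipodeM SVK.
Qed.

Lemma adjoint_integral_right W (E : H -> H -> W) y : lin2 E ->
  \tsum_(y1, y2 <- cop y) \tsum_(a, b <- cop Lam) E (a * Si y1) (S b * y2)
  = \tsum_(y1, y2 <- cop y) \tsum_(a, b <- cop Lam) E a (S y1 * S b * y2).
Proof.
move=> E2; apply: eq_tlift => y1 y2.
rewrite (integral_antipoder LamP (E := fun a b => E a (S b * y2))); last lin.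
by apply: eq_tlift => a b; rewrite antipodeM SVK.
Qed.
End RibbonIntegrals.

(** * The bimodules F and K *)

Section Bimodules.
Variables (k : fieldType) (H : falgType k) (A : hopf H).
Local Notation cop := (comul A).
Local Notation S := (antipode A).
Local Notation Si := (antipode A)^-1%VF.
Hypotheses (SK : cancel S Si) (SVK : cancel Si S).

Lemma dual_tensor_ext (f g : dual k (tensor H H)) :
  (forall a b, f (a \ox b) = g (a \ox b)) -> f = g.
Proof.
by move=> fg; apply/lfunP; apply: eq_tensor => //; exact: linearP.
Qed.

Lemma F_is_bimod : is_bimod (F_bimod A).
Proof.
split=> /=.
- move=> p c h h'; apply/lfunP => x; rewrite add_lfunE scale_lfunE !F_lactE.
  by rewrite linearP mulrDl -scalerAl linearP.
- move=> h c p p'; apply/lfunP => x; rewrite add_lfunE scale_lfunE !F_lactE.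
  by rewrite add_lfunE scale_lfunE.
- move=> h c p p'; apply/lfunP => x; rewrite add_lfunE scale_lfunE !F_ractE.
  by rewrite add_lfunE scale_lfunE.
- move=> p c h h'; apply/lfunP => x; rewrite add_lfunE scale_lfunE !F_ractE.
  by rewrite linearP mulrDr -scalerAr linearP.
- by move=> p; apply/lfunP => x; rewrite F_lactE antipode1 mul1r.
- by move=> g h p; apply/lfunP => x; rewrite !F_lactE antipodeM mulrA.
- by move=> p; apply/lfunP => x; rewrite F_ractE antipodeV1 // mulr1.
- by move=> p g h; apply/lfunP => x; rewrite !F_ractE antipodeVM // mulrA.
- by move=> g p h; apply/lfunP => x; rewrite F_lactE !F_ractE F_lactE mulrA.
Qed.

Lemma K_is_bimod : is_bimod (K_bimod A).
Proof.
split=> /=.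
- move=> f c h h'; apply: dual_tensor_ext => a b.
  rewrite add_lfunE scale_lfunE !K_lactE.
  by apply: (lin_tlift _ (f := cop)) => //; lin.
- move=> h c f f'; apply: dual_tensor_ext => a b.
  rewrite add_lfunE scale_lfunE !K_lactE.
  rewrite tlift_lincomb; apply: eq_tlift => h1 h2.
  by rewrite add_lfunE scale_lfunE.
- move=> h c f f'; apply: dual_tensor_ext => a b.
  rewrite add_lfunE scale_lfunE !K_ractE.
  rewrite tlift_lincomb; apply: eq_tlift => h1 h2.
  by rewrite add_lfunE scale_lfunE.
- move=> f c h h'; apply: dual_tensor_ext => a b.
  rewrite add_lfunE scale_lfunE !K_ractE.
  by apply: (lin_tlift _ (f := cop)) => //; lin.
- move=> f; apply: dual_tensor_ext => a b; rewrite K_lactE tlift_cop1; last lin.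
  by rewrite antipode1 mul1r mulr1.
- move=> g h f; apply: dual_tensor_ext => a b; rewrite !K_lactE tlift_copM; last lin.
  apply: eq_tlift => g1 g2; rewrite K_lactE; apply: eq_tlift => h1 h2.
  by rewrite antipodeM !mulrA.
- move=> f; apply: dual_tensor_ext => a b; rewrite K_ractE tlift_cop1; last lin.
  by rewrite antipodeV1 // mul1r mulr1.
- move=> f g h; apply: dual_tensor_ext => a b; rewrite !K_ractE tlift_copM; last lin.
  rewrite exchange_tlift.
  apply: eq_tlift => h1 h2; rewrite K_ractE; apply: eq_tlift => g1 g2.
  by rewrite antipodeVM // !mulrA.
- move=> g f h; apply: dual_tensor_ext => a b; rewrite K_lactE K_ractE.
  transitivity (\tsum_(g1, g2 <- cop g) \tsum_(h1, h2 <- cop h)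
    (f : dual k (tensor H H)) ((S g1 * a * g2) \ox (h2 * b * Si h1))).
    by apply: eq_tlift => g1 g2; rewrite K_ractE.
  by rewrite exchange_tlift; apply: eq_tlift => h1 h2; rewrite K_lactE.
Qed.
End Bimodules.

Section TraceFormula.
Variables (k : fieldType) (H : falgType k) (A : hopf H).
Local Notation cop := (comul A).
Local Notation S := (antipode A).
Local Notation Si := (antipode A)^-1%VF.
Hypotheses (SK : cancel S Si) (SVK : cancel Si S).
Variables (R : tensor H H) (v : H) (lam : dual k H).
Hypothesis lamP : right_cointegral A lam.
Local Notation t := (balancing A R v).
Local Notation Q := (monodromy R).

Lemma mon_act_lin (X : biact H) (f : K_bimod A) :
  is_bimod X -> linear (mon_act R f : X -> X).
Proof.
move=> Xb c x y; rewrite /mon_act tlift_lincomb; apply: eq_tlift => p p'.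
rewrite tlift_lincomb; apply: eq_tlift => q q'.
by rewrite lact_linr // ract_linl // scalerDr !scalerA mulrC.
Qed.

Lemma mon_act_FE (f : K_bimod A) (p : dual k H) y :
  (mon_act R f (p : F_bimod A) : dual k H) y
  = \tsum_(a, a' <- Q^-1) \tsum_(b, b' <- Q)
      (((f : dual k (tensor H H)) (a \ox b) : k) *: p (S a' * (y * Si b'))).
Proof.
rewrite /mon_act (lin_tliftE (f := fun g : dual k H => g y)); last lin.
apply: eq_tlift => a a'; rewrite (lin_tliftE (f := fun g : dual k H => g y)); last lin.
by apply: eq_tlift => b b'; rewrite scale_lfunE F_ractE F_lactE.
Qed.

Lemma monodromy_trace_F_comul (f : K_bimod A) y :
  (monodromy_trace R v (F_comul A lam) f : dual k H) y
  = \tsum_(y1, y2 <- cop y) \tsum_(p, p' <- Q^-1) \tsum_(q, q' <- Q)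
      (((f : dual k (tensor H H)) (p \ox q) : k)
        *: lam (S (S t * (S p' * (y2 * Si q') * Si t)) * y1)).
Proof.
pose beta y1 : dual k H := linfun (fun x => lam (S (S t * (x * Si t)) * y1)).
have betaE y1 x : beta y1 x = lam (S (S t * (x * Si t)) * y1).
  by rewrite lin_funE //; lin.
pose e := vbasis {:F_bimod A}.
(* Evaluating the first leg of Delta_F p at y leaves a combination of fixed functionals [beta y1]
   with coefficients p (y2). *)
have coefE (p : F_bimod A) : \tsum_(p1, p2 <- F_comul A lam p)
     ((p1 : dual k H) y *: ract (lact t p2) t)
   = \tsum_(y1, y2 <- cop y) ((p : dual k H) y2 *: beta y1).
  apply/lfunP => x.
  rewrite (lin_tliftE (f := fun g : dual k H => g x)); last lin.
  rewrite (lin_tliftE (f := fun g : dual k H => g x)); last lin.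
  transitivity (\tsum_(p1, p2 <- F_comul A lam p)
      ((p1 : dual k H) y * (p2 : dual k H) (S t * (x * Si t)) : k^o)).
    by apply: eq_tlift => p1 p2; rewrite scale_lfunE F_ractE F_lactE.
  rewrite F_comulE.
  have := congr1 (fun z => (p : dual k H) z)
    (cointegral_antipode_cop lamP (S t * (x * Si t)) y).
  rewrite !lfun_tlift => e1.
  transitivity (\tsum_(z1, z2 <- cop (S t * (x * Si t)))
     (p : dual k H) ((lam (S z2 * y) : k) *: z1)).
    by apply: eq_tlift => z1 z2; rewrite linearZ; exact: mulrC.
  rewrite e1; apply: eq_tlift => y1 y2.
  by rewrite scale_lfunE betaE linearZ; exact: mulrC.
rewrite monodromy_traceE sum_lfunE.
transitivity (\sum_(i < \dim {:F_bimod A}) \tsum_(y1, y2 <- cop y)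
   (((mon_act R f e`_i : dual k H) y2 : k) *: (coord e i (beta y1) : k^o))).
  apply: eq_bigr => i _.
  rewrite (lin_tliftE (f := fun g : dual k H => g y)); last lin.
  have := congr1 (coord e i) (coefE (mon_act R f e`_i)).
  rewrite !(lin_tliftE (f := coord e i : F_bimod A -> k^o)); try exact: linearP.
  move=> e1.
  transitivity (\tsum_(p1, p2 <- F_comul A lam (mon_act R f e`_i))
    (coord e i ((p1 : dual k H) y *: ract (lact t p2) t) : k^o)).
    by apply: eq_tlift => p1 p2; rewrite scale_lfunE linearZ; exact: mulrC.
  by rewrite e1; apply: eq_tlift => y1 y2; rewrite linearZ.
rewrite -tlift_sum; apply: eq_tlift => y1 y2.
(* The trace of the rank-one map p -> (f acting on p)(y2) [beta y1] is its functional evaluated at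
   [beta y1]. *)
transitivity ((mon_act R f (beta y1 : F_bimod A) : dual k H) y2).
  rewrite [in RHS](coord_vbasis (memvf (beta y1 : F_bimod A))).
  rewrite linear_sum_fun; last exact: mon_act_lin (F_is_bimod SK SVK).
  by rewrite sum_lfunE; apply: eq_bigr => i _; rewrite scale_lfunE; exact: mulrC.
rewrite mon_act_FE; apply: eq_tlift => p p'; apply: eq_tlift => q q'.
by rewrite betaE.
Qed.
End TraceFormula.

(** * Invariance of the trace *)

Section Invariance.
Variables (k : fieldType) (H : falgType k) (A : hopf H).
Local Notation cop := (comul A).
Local Notation S := (antipode A).
Local Notation Si := (antipode A)^-1%VF.
Implicit Types (a b h x y : H) (W : lmodType k).
Variables (R : tensor H H) (v Lam : H) (lam : dual k H).
Hypotheses (qtR : quasitriangular A R) (ribv : ribbon A R v).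
Hypotheses (LamP : two_sided_integral A Lam) (lamP : right_cointegral A lam)
  (lamLam : lam Lam = 1)
  (lamQ : \tsum_(a, b <- monodromy R) ((lam a : k) *: b) = Lam).
Local Notation t := (balancing A R v).
Local Notation Q := (monodromy R).
Local Notation tr := (monodromy_trace R v (F_comul A lam)).
Local Notation val f := (f : dual k (tensor H H)).

Let SK : cancel S Si := antipodeK LamP lamP lamLam.
Let SVK : cancel Si S := antipodeVK LamP lamP lamLam.
Let vu : v \is a GRing.unit := ribbon_unit ribv.
Let vC h : v * h = h * v := ribbon_central ribv h.
Let Sv : S v = v := ribbon_antipode ribv.

Lemma trace_Q (f : K_bimod A) y : (tr f : dual k H) y
  = \tsum_(p, p' <- Q^-1) \tsum_(q, q' <- Q) \tsum_(y1, y2 <- cop y)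
     ((lam (S (p' * y1) * y2 * Si q') : k) *: (val f (p \ox q) : k^o)).
Proof.
rewrite (monodromy_trace_F_comul SK SVK R v lamP).
under [RHS]eq_tlift do rewrite exchange_tlift.
rewrite [RHS]exchange_tlift.
apply: eq_tlift => y1 y2; apply: eq_tlift => p p'; apply: eq_tlift => q q'.
rewrite /GRing.scale /= mulrC; congr (_ * _).
(* Written as lam o S, the right side acquires t^2; sliding the inner t rightwards by t h = S^2 h t
   produces the two balancing factors of the trace. *)
have <- : S (Si (Si q') * Si y2 * (p' * y1)) = S (p' * y1) * y2 * Si q'.
  by rewrite !antipodeM !SVK !mulrA.
rewrite (cointegral_antipode qtR ribv LamP lamP lamLam); congr (lam _).
have tu := balancing_unit SK SVK qtR ribv.
have tS := antipode_balancing SK SVK qtR ribv.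
have tSi := antipodeV_balancing SK SVK qtR ribv.
have tC := balancing_antipode2 qtR ribv.
move: tu tS tSi tC; move: t => s su sS sSi sC.
rewrite sS sSi !antipodeM !SVK antipode_inv // sS invrK.
rewrite -[s * s * _]mulrA [s * (_ * (p' * y1))]mulrA (sC (Si (Si q') * Si y2)) !antipodeM !SVK.
by rewrite -!mulrA [S (S p') * _]mulrA -sC !mulrA.
Qed.

Lemma trace_adjoint (f : K_bimod A) y : (tr f : dual k H) y
  = \tsum_(y1, y2 <- cop y) \tsum_(a, b <- cop Lam)
      val f ((y2 * a * Si y1) \ox S b).
Proof.
rewrite trace_Q.
rewrite (Qinv_Q_integral qtR ribv LamP lamP lamLam lamQ
  (E := fun a b => val f (a \ox b) : k^o)) //; lin.
Qed.

Lemma trace_left (f : K_bimod A) y : (tr f : dual k H) y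
  = \tsum_(y1, y2 <- cop y) \tsum_(a, b <- cop Lam)
      val f ((a * Si y1) \ox (S b * y2)).
Proof.
rewrite trace_adjoint.
by apply: (adjoint_integral_left LamP lamP lamLam
  (E := fun a b => val f (a \ox b) : k^o)); lin.
Qed.

Lemma trace_right (f : K_bimod A) y : (tr f : dual k H) y
  = \tsum_(y1, y2 <- cop y) \tsum_(a, b <- cop Lam)
      val f (a \ox (S y1 * S b * y2)).
Proof.
rewrite trace_left.
by apply: (adjoint_integral_right LamP lamP lamLam
  (E := fun a b => val f (a \ox b) : k^o)); lin.
Qed.

(** Each action of H on K affects one leg only, so each side is checked on the formula where y acts
    on that leg alone. *)
Lemma trace_bimod_hom : bimod_hom (tr : 'Hom(K_bimod A, F_bimod A)).
Proof.
split; [exact: K_is_bimod|exact: F_is_bimod| |].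
- move=> h f; apply/lfunP => y; rewrite F_lactE !trace_adjoint.
  rewrite tlift_copM; last lin.
  rewrite cop_antipode tlift_tlift.
  under [RHS]eq_tlift => h1 h2 do (rewrite tlift_tens; last lin).
  rewrite [RHS]exchange_tlift; apply: eq_tlift => y1 y2.
  rewrite [RHS]exchange_tlift; apply: eq_tlift => a b.
  rewrite K_lactE; apply: eq_tlift => h1 h2.
  by rewrite antipodeVM // SK !mulrA.
- move=> f h; apply/lfunP => y; rewrite F_ractE !trace_right.
  rewrite tlift_copM; last lin.
  apply: eq_tlift => y1 y2; rewrite cop_antipodeV // tlift_tlift.
  under [RHS]eq_tlift => h1 h2 do (rewrite tlift_tens; last lin).
  rewrite [RHS]exchange_tlift; apply: eq_tlift => a b.
  rewrite K_ractE; apply: eq_tlift => h1 h2.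
  by rewrite antipodeM SVK !mulrA.
Qed.

(** As v = S v, it crosses from L_1 to L_2, where S (v L_2) v^-1 = S L_2. *)
Lemma trace_T f : tr (T_K A v f) = tr f.
Proof.
apply/lfunP => y; rewrite !trace_adjoint; apply: eq_tlift => y1 y2.
transitivity (\tsum_(a, b <- cop Lam) val f ((y2 * (S v * a) * Si y1) \ox (S b * v^-1))).
  by apply: eq_tlift => a b; rewrite T_KE Sv !mulrA vC.
rewrite (integral_antipodel LamP
  (E := fun a b => val f ((y2 * a * Si y1) \ox (S b * v^-1)) : k^o)); last lin.
by apply: eq_tlift => a b; rewrite antipodeM Sv mulrK.
Qed.

Lemma S_KE_scale (f : K_bimod A) a b : val (S_K A R lam f) (a \ox b)
  = \tsum_(p, p' <- Q^-1) \tsum_(q, q' <- Q)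
      ((lam (S p' * a) : k) *: ((lam (b * Si q') : k) *: (val f (p \ox q) : k^o))).
Proof.
rewrite S_KE; apply: (@eq_tlift k H H k^o) => p p'; apply: (@eq_tlift k H H k^o) => q q'.
by rewrite /GRing.scale /= -mulrA mulrC -mulrA.
Qed.

Lemma trace_S f : tr (S_K A R lam f) = tr f.
Proof.
apply/lfunP => y; rewrite trace_left trace_Q.
transitivity (\tsum_(y1, y2 <- cop y) \tsum_(p, p' <- Q^-1) \tsum_(q, q' <- Q)
  ((lam (S (p' * y1) * y2 * Si q') : k) *: (val f (p \ox q) : k^o))); last first.
  by rewrite exchange_tlift; apply: eq_tlift => p p'; rewrite exchange_tlift.
apply: eq_tlift => y1 y2; under eq_tlift => a b do rewrite S_KE_scale.
rewrite exchange_tlift; apply: eq_tlift => p p'.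
rewrite exchange_tlift; apply: eq_tlift => q q'.
(* S p' comes from S_K and Si y1 from [trace_left]; the result p' y1 takes the place of L_2 in the
   remaining lam (S L_2 y2 Si q'). *)
have e : \tsum_(a, b <- cop Lam) ((lam (S p' * a * Si y1) : k) *: b) = p' * y1.
  rewrite (integral_antipodel LamP (E := fun a b => (lam (a * Si y1) : k) *: b)); last lin.
  under eq_tlift do rewrite scalerAr.
  by rewrite -tlift_mulr integral_dual_basisr // SVK.
pose G z : k^o := (lam (S z * y2 * Si q') : k) *: (val f (p \ox q) : k^o).
have Gl : linear G by rewrite /G; lin.
rewrite -[RHS]/(G (p' * y1)) -e (lin_tliftE _ _ Gl); apply: eq_tlift => a b.
by rewrite (lin_funZ _ _ Gl) mulrA.
Qed.

(** The twist is already the identity on F, since p (v y v^-1) = p (y). *)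
Lemma trace_twist : (twist v (F_bimod A) \o tr)%VF = tr.
Proof.
apply/lfunP => f; rewrite comp_lfunE twistE; last exact: F_is_bimod.
apply/lfunP => y; rewrite F_ractE F_lactE Sv.
have -> : Si v^-1 = v^-1 by apply: (can_inj SK); rewrite SVK antipode_inv ?Sv.
by rewrite mulrA vC mulrK.
Qed.

(** Write a as sum lam (h L_2) L_1 and express Delta L through Q^-1 and Q. *)
Lemma Qinv_span a : exists2 beta : H -> k^o, linear beta &
  a = \tsum_(p, p' <- Q^-1) ((beta p' : k) *: p).
Proof.
have [h ->] := integral_surjl qtR ribv LamP lamP lamLam a.
exists (fun x => \tsum_(q, q' <- Q) ((lam (S x * q) : k) *: (lam (h * q') : k^o))).
  lin.
rewrite (integral_monodromy qtR ribv LamP lamP lamLam lamQ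
  (E := fun a b => (lam (h * b) : k) *: a)); last lin.
apply: eq_tlift => p p'; rewrite tlift_scalel; apply: eq_tlift => q q'.
by rewrite scalerA.
Qed.

(** Since Q = S q' (x) S q, it suffices to expand Si b in the second legs of Q, starting from Si b =
    sum lam (b L_1) L_2. *)
Lemma Q_span b : exists2 beta : H -> k^o, linear beta &
  b = \tsum_(q, q' <- Q) ((beta q' : k) *: q).
Proof.
pose d x : k^o := \tsum_(p, p' <- Q^-1) ((lam (S p' * x) : k) *: (lam (b * p) : k^o)).
have dl : linear d by rewrite /d; lin.
exists (fun x => d (Si x)); first lin.
rewrite -(Q_antipode SK SVK qtR); last lin.
under eq_tlift do rewrite SK -linearZ.
rewrite -lfun_tlift; apply: (can_inj SVK); rewrite SK.
rewrite -[LHS](integral_dual_basisl LamP lamP lamLam) SVK.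
rewrite (integral_monodromy qtR ribv LamP lamP lamLam lamQ
  (E := fun a c => (lam (b * a) : k) *: c)); last lin.
rewrite exchange_tlift; apply: eq_tlift => q q'; rewrite tlift_scalel.
by apply: eq_tlift => p p'; rewrite scalerA.
Qed.

Lemma S_K_inj : lker (S_K A R lam : 'End(K_bimod A)) == 0%VS.
Proof.
apply/lker0P => f g fg; apply: dual_tensor_ext => a b.
(* M f is a halfway house: the dual bases strip both lam from S_K f and yield M f, and since the p
   and the q span H, M f determines f. *)
pose M (f : dual k (tensor H H)) :=
  \tsum_(p, p' <- Q^-1) \tsum_(q, q' <- Q) ((f (p \ox q) : k) *: (p' \ox q')).
have ME (f' : K_bimod A) : M f' = \tsum_(a, a' <- cop Lam) \tsum_(b, b' <- cop Lam)
    (((S_K A R lam f' : dual k (tensor H H)) (a \ox b) : k) *: (a' \ox b')).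
  under [RHS]eq_tlift => x x' do under eq_tlift => z z' do rewrite S_KE_scale tlift_scalel.
  under [RHS]eq_tlift => x x' do rewrite exchange_tlift.
  rewrite [RHS]exchange_tlift; apply: eq_tlift => p p'.
  under [RHS]eq_tlift => x x' do under eq_tlift => z z' do rewrite tlift_scalel.
  under [RHS]eq_tlift => x x' do rewrite exchange_tlift.
  rewrite [RHS]exchange_tlift; apply: eq_tlift => q q'.
  rewrite -{1}[p'](integral_dual_basisl LamP lamP lamLam).
  rewrite -{1}[q']SVK -{1}(integral_dual_basisr LamP lamP lamLam (Si q')).
  rewrite (lin_tliftE (f := fun z => _ *: (z \ox _))); last lin.
  apply: eq_tlift => x x'.
  rewrite (lin_tliftE (f := fun z => _ *: (_ \ox z))); last lin.
  apply: eq_tlift => z z'.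
  rewrite (lin_funZ (f := fun z => z \ox _)); last lin.
  rewrite (lin_funZ (f := fun z => x' \ox z)); last lin.
  by rewrite !scalerA; congr (_ *: _); exact: mulrC.
have {}fg : M f = M g by rewrite !ME fg.
have [be bel ea] := Qinv_span a; have [ga gal eb] := Q_span b.
have fE (f' : dual k (tensor H H)) :
    f' (a \ox b) = \tsum_(x, y <- M f') ((be x : k) *: (ga y : k^o)).
  rewrite {1}ea (lin_tliftE (f := fun z => f' (z \ox b))); last lin.
  rewrite tlift_tlift; apply: eq_tlift => p p'.
  rewrite {1}eb (lin_tliftE (f := fun z => f' (_ \ox z))); last lin.
  rewrite tlift_tlift; apply: eq_tlift => q q'.
  rewrite linearZ /= tlift_tens; last lin.
  rewrite (lin_funZ (f := fun z => f' (z \ox _))); last lin.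
  rewrite (lin_funZ (f := fun z => f' (p \ox z))); last lin.
  by rewrite /GRing.scale /= mulrA mulrC.
by rewrite !fE fg.
Qed.

Lemma T_K_inj : lker (T_K A v : 'End(K_bimod A)) == 0%VS.
Proof.
apply/lker0P => f g fg; apply: dual_tensor_ext => a b.
have := congr1 (fun h : dual k (tensor H H) => h ((v^-1 * a) \ox (b * v))) fg.
by rewrite !T_KE !mulrA divrr // mul1r -!mulrA divrr // mulr1.
Qed.

Lemma trace_Gamma11_invariant : Gamma11_invariant R v lam tr.
Proof.
split; last exact: trace_twist; apply/lfunP => f; rewrite comp_lfunE.
- by rewrite -trace_S lker0_lfunVK // S_K_inj.
- by rewrite -trace_T lker0_lfunVK // T_K_inj.
Qed.
End Invariance.

Theorem theorem5p7 (k : closedFieldType) (char0 : [pchar k] =i pred0)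
    (H : falgType k) (A : hopf H) (R : tensor H H) (v : H)
    (qtR : quasitriangular A R) (ribv : ribbon A R v) (factR : factorizable R)
    (Lam : H) (lam : 'Hom(H, k^o))
    (integrals : normalized_integrals A R Lam lam) :
  let tr : 'Hom(K_bimod A, F_bimod A) :=
    monodromy_trace R v (F_comul A lam) in
  bimod_hom tr /\ Gamma11_invariant R v lam tr.
Proof.
move=> tr; case: integrals => -[LamP _] [lamP _] lamLam lamQ; split.
- exact: trace_bimod_hom qtR ribv LamP lamP lamLam lamQ.
- exact: trace_Gamma11_invariant qtR ribv LamP lamP lamLam lamQ.
Qed.
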